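(* Let $K$ be an algebraically closed field that is complete with respect to a non-trivial and non-archimedean absolute value, and let $E$ be a compact subset in $\mathsf{P}^1=\mathsf{P}^1(K)$. Then $E$ has the bounded moduli property for its separating annuli if and only if $E$ has the (non-infinitesimal) lower capacity density property (for some $c\in(0,1)$).
   Context: $K$ has arbitrary characteristic. **Berkovich projective line.** $\mathbb{P}^1=\mathbb{P}^1(K)=K\cup\{\infty\}$, and $\mathsf{P}^1=\mathsf{P}^1(K)$ is its Berkovich analytification. A $K$-closed disk is $B(a,r)=\{z\in K:|z-a|\le r\}$, $a\in K$, $r\ge 0$. Points of $\mathsf{P}^1$: type I points are the points of $\mathbb{P}^1$ (with $a\in K$ identified with $B(a,0)$); type II (resp. type III) points correspond to the $K$-closed disks of radius $r\in|K^*|$ (resp. $r\in\mathbb{R}_{>0}\setminus|K^*|$); type IV points are the (cofinal equivalence classes of) decreasing nested sequences of $K$-closed disks with empty intersection. For a non-type-IV point $\mathcal{S}\ne\infty$, $B_{\mathcal{S}}$ is the corresponding disk. Set $\mathsf{H}^1=\mathsf{P}^1\setminus\mathbb{P}^1$ and $\mathsf{A}^1=\mathsf{P}^1\setminus\{\infty\}$. Inclusion of disks extends to a partial order $\preceq$ on $\mathsf{P}^1$ (with strict version $\prec$): $\mathcal{S}\prec\mathcal{S}'$ iff $B_{\mathcal{S}}\subsetneq B_{\mathcal{S}'}$ for points other than $\infty$ and type IV points, $\infty$ is the maximum element, and the minimal elements are exactly the points of $K$ and the type IV points. Any two points have a least upper bound $\mathcal{S}\wedge\mathcal{S}'$. Intervals: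 $[\mathcal{S},\mathcal{S}']=\{\mathcal{S}'':\mathcal{S}\preceq\mathcal{S}''\preceq\mathcal{S}'\}$ if $\mathcal{S}\preceq\mathcal{S}'$, and $[\mathcal{S},\mathcal{S}']=[\mathcal{S},\mathcal{S}\wedge\mathcal{S}']\cup[\mathcal{S}\wedge\mathcal{S}',\mathcal{S}']$ in general. A direction at $\mathcal{S}$ is a germ $\overrightarrow{\mathcal{S}\mathcal{S}'}$ at $\mathcal{S}$ of half-open intervals $(\mathcal{S},\mathcal{S}']$, $\mathcal{S}'\ne\mathcal{S}$; for a direction $\vec v$ at $\mathcal{S}$, $U_{\vec v}=\{\mathcal{S}'\ne\mathcal{S}:\overrightarrow{\mathcal{S}\mathcal{S}'}=\vec v\}$. The topology of $\mathsf{P}^1$ (the weak topology) has as a subbasis the sets $U_{\vec v}$, $\vec v$ a direction at a type II point; $\mathsf{P}^1$ is compact, Hausdorff and uniquely arcwise connected, and the $U_{\vec v}$ with $\vec v$ a direction at $\mathcal{S}$ are the components of $\mathsf{P}^1\setminus\{\mathcal{S}\}$. The function $\operatorname{diam}:\mathsf{P}^1\to[0,+\infty]$ is $\operatorname{diam}\mathcal{S}=$ the radius of $B_{\mathcal{S}}$ for types I, II, III ($\mathcal{S}\ne\infty$), the limit of the radii for type IV points, and $\operatorname{diam}\infty=+\infty$; so $\mathsf{H}^1=\{0<\operatorname{diam}<+\infty\}$. **Bounded moduli property.** A concentric annulus in $\mathsf{A}^1$ is a set $A=A(\mathcal{S},\mathcal{S}')=U_{\overrightarrow{\mathcal{S}\mathcal{S}'}}\cap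 U_{\overrightarrow{\mathcal{S}'\mathcal{S}}}$ with $\mathcal{S},\mathcal{S}'\in\mathsf{H}^1$, $\mathcal{S}\prec\mathcal{S}'$; its modulus is $\operatorname{mod}A=\log(\operatorname{diam}\mathcal{S}'/\operatorname{diam}\mathcal{S})>0$. It separates $E\subset\mathsf{P}^1$ if $A\subset\mathsf{P}^1\setminus E$, $E\cap(\mathsf{P}^1\setminus U_{\overrightarrow{\mathcal{S}\mathcal{S}'}})\ne\emptyset$ and $E\cap(\mathsf{P}^1\setminus U_{\overrightarrow{\mathcal{S}'\mathcal{S}}})\ne\emptyset$. $E$ has the bounded moduli property for its separating annuli if $\sup\{\operatorname{mod}A: A\text{ a concentric annulus in }\mathsf{A}^1\text{ separating }E\}<+\infty$ (with $\sup\emptyset=0$). **Lower capacity density.** The Hsia kernel is $|\mathcal{S}-\mathcal{S}'|_\infty=\operatorname{diam}(\mathcal{S}\wedge\mathcal{S}')$ for $\mathcal{S},\mathcal{S}'\in\mathsf{A}^1$ (extending $|z-w|$ on $K\times K$), with value $+\infty$ if $\mathcal{S}$ or $\mathcal{S}'$ is $\infty$. Set $\operatorname{diam}_\infty E=\sup\{|\mathcal{S}-\mathcal{S}'|_\infty:\mathcal{S},\mathcal{S}'\in E\}\in[0,+\infty]$ for non-empty $E$ (so it is $+\infty$ if $\infty\in E$). For $\mathcal{S}_0\in\mathsf{A}^1$ and $r\ge\operatorname{diam}\mathcal{S}_0$, $\mathsf{B}(\mathcal{S}_0,r)=\{\mathcal{S}\in\mathsf{A}^1:|\mathcal{S}-\mathcal{S}_0|_\infty\le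 r\}$. For compact $C\subset\mathsf{A}^1$, the logarithmic capacity with pole $\infty$ is $\operatorname{Cap}_\infty(C)=\exp\bigl(\sup_\nu\int\int\log|\mathcal{S}-\mathcal{S}'|_\infty\,d\nu(\mathcal{S})\,d\nu(\mathcal{S}')\bigr)$, where $\nu$ ranges over all probability Radon measures supported by $C$, and $\operatorname{Cap}_\infty(\emptyset)=0$. A compact subset $E$ of $\mathsf{P}^1$ has the (non-infinitesimal) lower capacity density property if there is $c\in(0,1)$ such that for every $\mathcal{S}\in E\setminus\{\infty\}$ and every $r\in(\operatorname{diam}\mathcal{S},\operatorname{diam}_\infty E)$, $\operatorname{Cap}_\infty(E\cap\mathsf{B}(\mathcal{S},r))\ge cr$. *)

(* Defs.v *)
From HB Require Import structures.
From mathcomp Require Import all_boot all_order all_algebra.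
From mathcomp Require Import all_classical all_reals all_analysis.

Set Implicit Arguments.
Unset Strict Implicit.
Unset Printing Implicit Defensive.

Import Order.TTheory GRing.Theory Num.Theory.
Import numFieldNormedType.Exports.

Local Open Scope classical_set_scope.
Local Open Scope ring_scope.

Record nonarch_absval (R : realType) (K : fieldType) := NonarchAbsval {
  absval :> K -> R ;
  absval_ge0 : forall x, 0 <= absval x ;
  absval_eq0 : forall x, absval x = 0 <-> x = 0 ;
  absvalM : forall x y, absval (x * y) = absval x * absval y ;
  absvalD : forall x y, absval (x + y) <= Num.max (absval x) (absval y)
}.

Definition nontrivial (R : realType) (K : fieldType)
    (v : nonarch_absval R K) : Prop :=
  exists x : K, x != 0 /\ v x != 1.

Definition complete_absval (R : realType) (K : fieldType)
    (v : nonarch_absval R K) : Prop :=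
  forall u : nat -> K,
    (forall e : R, 0 < e -> exists N : nat, forall m n : nat,
      (N <= m)%N -> (N <= n)%N -> v (u m - u n) < e) ->
    exists l : K, v (u n - l) @[n --> \oo] --> (0 : R).

Section Points.
Context {R : realType} {K : fieldType}.
Variable v : nonarch_absval R K.

Definition cdisk (a : K) (r : R) : set K := [set z | v (z - a) <= r].

Definition is_cdisk (B : set K) : Prop :=
  exists (a : K) (r : R), 0 <= r /\ B = cdisk a r.

(* The radius of a disk is unique as soon as |K^*| is dense in the positive
   reals, in particular if K is algebraically closed and v non-trivial. *)
Definition radius (B : set K) : R :=
  xget 0 [set r | 0 <= r /\ exists a, B = cdisk a r].

Record nested_disks := NestedDisks {
  nested_seq :> nat -> set K ;
  nested_is_cdisk : forall n, is_cdisk (nested_seq n) ;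
  nested_decr : forall n, nested_seq n.+1 `<=` nested_seq n ;
  nested_empty : \bigcap_n nested_seq n = set0
}.

HB.instance Definition _ := gen_eqMixin nested_disks.
HB.instance Definition _ := gen_choiceMixin nested_disks.

Definition finer (D D' : nested_disks) : Prop :=
  forall n, exists m, D m `<=` D' n.

Lemma finer_refl D : finer D D.
Proof. by move=> n; exists n. Qed.

Lemma finer_trans D1 D2 D3 : finer D1 D2 -> finer D2 D3 -> finer D1 D3.
Proof.
move=> h12 h23 n; have [m hm] := h23 n; have [k hk] := h12 m.
by exists k; exact: subset_trans hk hm.
Qed.

Definition cofinal (D D' : nested_disks) : bool :=
  `[< finer D D' /\ finer D' D >].

Lemma cofinal_refl : reflexive cofinal.
Proof. by move=> D; apply/asboolP; split; exact: finer_refl. Qed.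

Lemma cofinal_sym : symmetric cofinal.
Proof. by move=> D D'; apply/asboolP/asboolP => -[]. Qed.

Lemma cofinal_trans : transitive cofinal.
Proof.
move=> D2 D1 D3 /asboolP[h12 h21] /asboolP[h23 h32]; apply/asboolP; split.
  exact: finer_trans h12 h23.
exact: finer_trans h32 h21.
Qed.

Definition cofinal_equiv : equiv_rel nested_disks :=
  EquivRel cofinal cofinal_refl cofinal_sym cofinal_trans.

Definition typeIV := {eq_quot cofinal_equiv}%qT.

(* [Disk] gathers the points of types I (other than oo), II and III. *)
Inductive P1 :=
| Disk of {B : set K | is_cdisk B}
| TypeIV of typeIV
| Infty.

HB.instance Definition _ := gen_eqMixin P1.
HB.instance Definition _ := gen_choiceMixin P1.
HB.instance Definition _ := isPointed.Build P1 Infty.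

Definition leP1 (S S' : P1) : Prop :=
  match S, S' with
  | _, Infty => True
  | Infty, _ => False
  | Disk B, Disk B' => sval B `<=` sval B'
  | Disk _, TypeIV _ => False
  | TypeIV D, Disk B => exists n, (repr D : nested_disks) n `<=` sval B
  | TypeIV D, TypeIV D' => D = D'
  end.

Lemma leP1_refl : reflexive (fun S S' => `[< leP1 S S' >]).
Proof. by move=> [B|D|]; apply/asboolP => //=. Qed.

Lemma leP1_anti : antisymmetric (fun S S' => `[< leP1 S S' >]).
Proof.
move=> [B|D|] [B'|D'|] /andP[/asboolP h /asboolP h'] //=; last by rewrite h.
congr Disk; case: B B' h h' => [B hB] [B' hB'] /= h h'.
exact/eq_exist/seteqP.
Qed.

Lemma leP1_trans : transitive (fun S S' => `[< leP1 S S' >]).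
Proof.
move=> [B2|D2|] [B1|D1|] [B3|D3|] /asboolP /= h12 /asboolP /= h23;
  apply/asboolP => //=.
- exact: subset_trans h12 h23.
- by case: h12 => n hn; exists n; exact: subset_trans hn h23.
- by rewrite h12.
- by rewrite h12.
Qed.

Fact P1_display : Order.disp_t. Proof. exact: Order.Disp tt tt. Qed.

HB.instance Definition _ := Order.Le_isPOrder.Build P1_display P1
  leP1_refl leP1_anti leP1_trans.

Definition lub (S S' : P1) : P1 := supremum Infty [set S; S'].

Definition typeI (S : P1) : Prop :=
  match S with
  | Disk B => exists a, sval B = cdisk a 0
  | TypeIV _ => False
  | Infty => True
  end.

Definition typeII (S : P1) : Prop :=
  match S with
  | Disk B => exists a z, z != 0 /\ sval B = cdisk a (v z)
  | _ => False
  end.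

Definition H1 : set P1 := [set S | ~ typeI S].

Definition diam (S : P1) : \bar R :=
  match S with
  | Disk B => (radius (sval B))%:E
  | TypeIV D =>
      (lim (radius ((repr D : nested_disks) n) @[n --> \oo]))%:E
  | Infty => +oo%E
  end.

Definition seg (S S' : P1) : set P1 :=
  [set T | (S <= T <= lub S S')%O] `|` [set T | (S' <= T <= lub S S')%O].

(* (S, S'] *)
Definition oseg (S S' : P1) : set P1 := seg S S' `\ S.

(* The intervals (S, S'] and (S, S''] have the same germ at S. *)
Definition same_germ (S S' S'' : P1) : Prop :=
  exists T, T <> S /\ oseg S T `<=` oseg S S' `&` oseg S S''.

(* U_v for v the direction at S towards S'; every direction at S is of this
   form, with S' <> S. *)
Definition Udir (S S' : P1) : set P1 :=
  [set T | T <> S /\ same_germ S S' T].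

HB.instance Definition _ := isSubBaseTopological.Build P1
  [set p : P1 * P1 | typeII p.1 /\ p.2 <> p.1] (fun p => Udir p.1 p.2).

Definition annulus (S S' : P1) : set P1 := Udir S S' `&` Udir S' S.

Definition modulus (S S' : P1) : R := ln (fine (diam S') / fine (diam S)).

Definition separating_annulus (E : set P1) (S S' : P1) : Prop :=
  [/\ H1 S, H1 S' & (S < S')%O] /\
  [/\ annulus S S' `<=` ~` E,
      E `&` ~` Udir S S' !=set0 &
      E `&` ~` Udir S' S !=set0].

(* The added 0 realizes the convention sup set0 = 0: moduli are positive. *)
Definition bounded_moduli (E : set P1) : Prop :=
  (ereal_sup (0%E |` [set (modulus p.1 p.2)%:E |
      p in [set p : P1 * P1 | separating_annulus E p.1 p.2]]) < +oo)%E.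

(* For S or S' = oo the least upper bound is oo, and the value is +oo. *)
Definition hsia (S S' : P1) : \bar R := diam (lub S S').

Definition diam_infty (E : set P1) : \bar R :=
  ereal_sup [set hsia S S' | S in E & S' in E].

Definition ballP1 (S0 : P1) (r : R) : set P1 :=
  [set S | S <> Infty /\ (hsia S S0 <= r%:E)%E].

Definition borelP1 := g_sigma_algebraType (@open P1).

Definition radon (nu : probability borelP1 R) : Prop :=
  forall A : set borelP1, measurable A ->
    nu A = ereal_sup [set nu C | C in [set C : set P1 | compact C /\ C `<=` A]].

(* For C compact, hence closed, this says that the support of nu lies in C. *)
Definition supported_by (C : set P1) (nu : probability borelP1 R) : Prop :=
  nu (~` C) = 0%E.

Definition energy (nu : probability borelP1 R) : \bar R :=
  (\int[nu]_S \int[nu]_S' lne (hsia S S'))%E.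

(* For C = set0 the supremum is -oo and the capacity expeR -oo = 0. *)
Definition capacity (C : set P1) : \bar R :=
  expeR (ereal_sup [set energy nu |
    nu in [set nu : probability borelP1 R | radon nu /\ supported_by C nu]]).

Definition lower_capacity_density (E : set P1) : Prop :=
  exists c : R, 0 < c < 1 /\
    forall (S : P1) (r : R), E S -> S <> Infty ->
      (diam S < r%:E)%E -> (r%:E < diam_infty E)%E ->
      ((c * r)%:E <= capacity (E `&` ballP1 S r))%E.

End Points.

(* Main.v *)
From HB Require Import structures.
From mathcomp Require Import all_boot all_order all_algebra finmap.
From mathcomp Require Import all_classical all_reals all_analysis.
From mathcomp Require Import measurable_realfun lra.
Require Import Defs.

(** The points above a given point form a chain. If an annulus A(S, S')
    separates E and a point T of E lies below S, then every point of E at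
    Hsia distance less than diam S' from T also lies below S, so that the capacity
    of E in such a ball is at most diam S; a lower density c then bounds the
    modulus by - ln c.

    Conversely, if all moduli are less than - ln q, then for S in E and
    rho < diam_infty E the annulus q rho < |. - S| < rho meets E as soon as
    diam S <= q rho. Iterating, one obtains a binary tree of points of E in
    which the two branches issued from a vertex of level n stay more than
    q^(n+1) r apart. The push-forward of the Lebesgue measure of [0, 1[ to the
    leaves gives mass at most 2^-n to every ball of radius q^n r, so its
    potential is everywhere at least ln r + sum_n 2^-n ln q = ln (q^2 r). *)

Set Implicit Arguments.
Unset Strict Implicit.
Unset Printing Implicit Defensive.

Import Order.TTheory GRing.Theory Num.Theory.
Import numFieldNormedType.Exports.

Local Open Scope classical_set_scope.
Local Open Scope ring_scope.

(** * Disks of a non-archimedean field *)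

Section Absval.
Context {R : realType} {K : fieldType} (v : nonarch_absval R K).

Lemma absval0 : v 0 = 0.
Proof. exact/absval_eq0. Qed.

Lemma absval_gt0 x : (0 < v x) = (x != 0).
Proof.
rewrite lt_neqAle absval_ge0 andbT eq_sym; congr (~~ _).
by have [h h'] := absval_eq0 v x; apply/eqP/eqP.
Qed.

Lemma absval1 : v 1 = 1.
Proof.
have v1 : v 1 != 0 by rewrite gt_eqF// absval_gt0 oner_eq0.
by apply: (mulfI v1); rewrite -absvalM !mulr1.
Qed.

Lemma absvalX x n : v (x ^+ n) = v x ^+ n.
Proof.
elim: n => [|n IH]; first by rewrite !expr0 absval1.
by rewrite !exprS absvalM IH.
Qed.

Lemma absvalV x : v x^-1 = (v x)^-1.
Proof.
have [->|x0] := eqVneq x 0; first by rewrite invr0 absval0 invr0.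
have vx : v x != 0 by rewrite gt_eqF// absval_gt0.
by apply: (mulfI vx); rewrite -absvalM !divff// absval1.
Qed.

Lemma absvalN x : v (- x) = v x.
Proof.
have v2 : v (-1) ^+ 2 = 1 by rewrite -absvalX sqrrN expr1n absval1.
have vN1 : v (-1) = 1.
  by apply/eqP; rewrite -(eqrXn2 (n := 2))// ?absval_ge0// v2 expr1n.
by rewrite -[- x]mulN1r absvalM vN1 mul1r.
Qed.

Lemma absval_subC x y : v (x - y) = v (y - x).
Proof. by rewrite -absvalN opprB. Qed.

Lemma absval_ultra z x y : v (x - y) <= Num.max (v (x - z)) (v (z - y)).
Proof. by have := absvalD v (x - z) (z - y); rewrite addrA subrK. Qed.

End Absval.

(** Algebraic closedness enters here, through roots of [x]. Density makes the radius of a disk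
    unique and supplies type II points between any two diameters. *)
Lemma absval_dense (R : realType) (K : closedFieldType)
    (v : nonarch_absval R K) :
  nontrivial v -> forall a b : R, 0 <= a -> a < b ->
  exists2 z : K, z != 0 & a < v z < b.
Proof.
move=> [x0 [x0_neq0 vx0_neq1]].
have [x x_neq0 vx1] : exists2 x, x != 0 & 1 < v x.
  have [h|h|h] := ltgtP (v x0) 1; last by rewrite h eqxx in vx0_neq1.
    exists x0^-1; first by rewrite invr_eq0.
    by rewrite absvalV invf_gt1// absval_gt0.
  by exists x0.
(* The lower end may be 0, where the logarithm is useless; the midpoint of [a] and [b] replaces
   it. *)
move=> a b a0; wlog {a0} a0 : a / 0 < a => [wl ab|ab].
  have a_lt : a < (a + b) / 2 by lra.
  have lt_b : (a + b) / 2 < b by lra.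
  have [|//|z z0 /andP[az zb]] := wl ((a + b) / 2); first by lra.
  by exists z => //; rewrite zb (lt_trans a_lt).
pose l := ln (v x); have l0 : 0 < l by rewrite ln_gt0.
have b0 : 0 < b := lt_trans a0 ab.
pose d := ln b - ln a.
have d0 : 0 < d by rewrite subr_gt0 ltr_ln.
(* an n-th root y of x has |y| so close to 1 that a power of y hits (a, b) *)
pose n := (Num.truncn (l / d)).+1.
have nd : l < d * n%:R.
  have := truncnS_gt (l / d); rewrite ltr_pdivrMr// mulrC; exact.
have [y yx] : exists y : K, y ^+ n = x.
  have [y] := @solve_monicpoly K n (fun i => if i is 0%N then x else 0) isT.
  rewrite big_ord_recl/= expr0 mulr1 big1 ?addr0; last first.
    by move=> i _; rewrite mul0r.
  by move=> yE; exists y.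
have y0 : y != 0 by apply: contraNneq x_neq0 => y0; rewrite -yx y0 expr0n.
have vy0 : 0 < v y by rewrite absval_gt0.
pose e := ln (v y).
have le : l = e * n%:R by rewrite /l -yx absvalX lnXn// mulr_natr.
have n0 : 0 < n%:R :> R by rewrite ltr0n.
have e0 : 0 < e by rewrite -(pmulr_lgt0 _ n0) -le.
have ed : e < d by rewrite -(ltr_pM2r n0) -le.
(* [k] is the least integer with [ln a < k * e], so [k * e <= ln a + e < ln a + d = ln b]. *)
pose k := Num.floor (ln a / e) + 1.
have := floorD1_gt (ln a / e); rewrite -/k ltr_pdivrMr// => ak.
have := ge_floor (ln a / e); rewrite ler_pdivlMr// => ka.
exists (y ^ k); first by rewrite expfz_neq0.
have vyk : v (y ^ k) = v y ^ k.
  case: (k) => m; first exact: absvalX.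
  by rewrite !NegzE -!exprnN absvalV absvalX.
have vyk0 : 0 < v y ^ k by rewrite exprz_gt0.
have lnyk : ln (v y ^ k) = k%:~R * e.
  case: (k) => m; first by rewrite -exprnP lnXn// -mulr_natl.
  rewrite NegzE -exprnN lnV ?posrE ?exprn_gt0// lnXn//.
  by rewrite rmorphN/= mulNr -mulr_natl.
rewrite vyk -(ltr_ln a0)// -(@ltr_ln _ (v y ^ k) b)// lnyk ak/=.
have -> : k%:~R * e = (Num.floor (ln a / e))%:~R * e + e.
  by rewrite /k intrD mulrDl mul1r.
by apply: le_lt_trans (lerD ka (lexx e)) _; rewrite -ltrBrDl.
Qed.

Section Disks.
Context {R : realType} {K : closedFieldType} (v : nonarch_absval R K).
Hypothesis v_nontrivial : nontrivial v.

Lemma cdisk_center a r : 0 <= r -> cdisk v a r a.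
Proof. by move=> r0; rewrite /cdisk/= subrr absval0. Qed.

Lemma cdisk_subset a b r s : r <= s -> cdisk v b s a ->
  cdisk v a r `<=` cdisk v b s.
Proof.
move=> rs ab z /= za; apply: le_trans (absval_ultra v a z b) _.
by rewrite ge_max ab (le_trans za).
Qed.

Lemma cdisk_recenter a b r : cdisk v b r a -> cdisk v b r = cdisk v a r.
Proof.
move=> ab; apply/seteqP; split; apply: cdisk_subset => //.
by rewrite /cdisk/= absval_subC.
Qed.

(** Were [s < r], density would give [z] with [s < v z < r]; then [a] and [z + a] would both lie in
    a disk of radius [s], forcing [v z <= s]. *)
Lemma cdisk_subset_radius a b r s : 0 <= r -> 0 <= s ->
  cdisk v a r `<=` cdisk v b s -> r <= s.
Proof.
move=> r0 s0 ab; rewrite leNgt; apply/negP => sr.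
have [z z0 /andP[sz zr]] := absval_dense v_nontrivial s0 sr.
have h1 : v (z + a - b) <= s.
  by apply: ab; rewrite /cdisk/= addrK ltW.
have h2 : v (b - a) <= s.
  by rewrite absval_subC; apply: ab; exact: cdisk_center.
suff : v z <= s by rewrite leNgt sz.
have := absval_ultra v b (z + a) a; rewrite addrK => /le_trans; apply.
by rewrite ge_max h1.
Qed.

Lemma radius_cdisk a r : 0 <= r -> radius v (cdisk v a r) = r.
Proof.
move=> r0; rewrite /radius; case: xgetP => [s _ [s0 [b ab]]|/(_ r)]; last first.
  by case; split => //; exists a.
apply: le_anti; rewrite (@cdisk_subset_radius b a)//= -?ab//.
by rewrite (@cdisk_subset_radius a b)//= -?ab.
Qed.

Lemma is_cdiskP B : is_cdisk v B -> exists2 a, B a & B = cdisk v a (radius v B).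
Proof.
move=> [a [r [r0 ->]]]; exists a; first exact: cdisk_center.
by rewrite radius_cdisk.
Qed.

Lemma is_cdisk_cdisk a r : 0 <= r -> is_cdisk v (cdisk v a r).
Proof. by move=> r0; exists a, r. Qed.

Lemma radius_ge0 B : is_cdisk v B -> 0 <= radius v B.
Proof. by move=> [a [r [r0 ->]]]; rewrite radius_cdisk. Qed.

Lemma cdisk_in B a : is_cdisk v B -> B a -> B = cdisk v a (radius v B).
Proof. by move=> /is_cdiskP[b _ ->] Ba; rewrite radius_cdisk
  ?(cdisk_recenter Ba) ?radius_cdisk// (le_trans _ Ba)// absval_ge0. Qed.

Lemma radius_le B B' : is_cdisk v B -> is_cdisk v B' -> B `<=` B' ->
  radius v B <= radius v B'.
Proof.
move=> dB dB' BB'; have [a _ Ba] := is_cdiskP dB;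
  have [b _ B'b] := is_cdiskP dB'.
apply: (@cdisk_subset_radius a b); rewrite ?radius_ge0//.
by rewrite -Ba -B'b.
Qed.

Lemma cdisk_meet B B' a : is_cdisk v B -> is_cdisk v B' -> B a -> B' a ->
  radius v B <= radius v B' -> B `<=` B'.
Proof.
move=> dB dB' Ba B'a rB; rewrite (cdisk_in dB Ba) (cdisk_in dB' B'a).
by apply: cdisk_subset => //; apply: cdisk_center; exact: radius_ge0.
Qed.

Lemma cdisk_total B B' a : is_cdisk v B -> is_cdisk v B' -> B a -> B' a ->
  B `<=` B' \/ B' `<=` B.
Proof.
move=> dB dB' Ba B'a; have [rB|rB] := leP (radius v B) (radius v B').
  by left; apply: cdisk_meet Ba B'a rB.
by right; apply: cdisk_meet B'a Ba (ltW rB).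
Qed.

Lemma cdisk_eq B B' : is_cdisk v B -> is_cdisk v B' -> B `<=` B' ->
  radius v B' <= radius v B -> B = B'.
Proof.
move=> dB dB' BB' rB; apply/seteqP; split => //.
by have [a Ba _] := is_cdiskP dB; apply: cdisk_meet (BB' _ Ba) Ba rB.
Qed.

End Disks.

(** * The tree order on the Berkovich line *)

Section Tree.
Context {R : realType} {K : closedFieldType} (v : nonarch_absval R K).
Hypothesis v_nontrivial : nontrivial v.
Implicit Types (S T P Q W : P1 v) (D : nested_disks v).

Lemma le_P1E S T : (S <= T)%O <-> leP1 S T.
Proof. by split=> [/asboolP|h]//; apply/asboolP. Qed.

Lemma le_Infty S : (S <= Infty v)%O.
Proof. by apply/le_P1E; case: S. Qed.

Lemma Infty_le S : (Infty v <= S)%O -> S = Infty v.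
Proof. by move=> h; apply/eqP; rewrite eq_le le_Infty. Qed.

Lemma nested_le D n m : (n <= m)%N -> D m `<=` D n.
Proof.
elim: m => [|m IH]; first by rewrite leqn0 => /eqP ->.
rewrite leq_eqVlt => /predU1P[->//|]; rewrite ltnS => /IH; apply: subset_trans.
exact: nested_decr.
Qed.

Lemma nested_not_subset D B : is_cdisk v B -> exists n, ~ B `<=` D n.
Proof.
move=> /(is_cdiskP v_nontrivial)[a Ba _]; apply: contrapT => /forallNP h.
suff : (\bigcap_n D n) a by rewrite nested_empty.
by move=> n _; have /contrapT := h n; exact.
Qed.

(** If [B] meets every [D n], it is nested with each of them, and it cannot be contained in all
    since their intersection is empty. *)
Lemma nested_comparable D B : is_cdisk v B ->
  (exists n, D n `<=` B) \/ (exists n, D n `&` B = set0).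
Proof.
move=> dB; have [[n h]|h] := pselect (exists n, D n `&` B = set0).
  by right; exists n.
left; have [n hn] := nested_not_subset D dB.
have [a [Da Ba]] : D n `&` B !=set0.
  by apply/set0P/negP => /eqP h'; apply: h; exists n.
by have [|//] := cdisk_total v_nontrivial (nested_is_cdisk D n) dB Da Ba;
  exists n.
Qed.

(** Two disks above [S] share a point of [K], taken in the disk [S] or in a late enough term of a
    type IV sequence, and disks sharing a point are nested. *)
Lemma le_total_above S T T' : (S <= T)%O -> (S <= T')%O ->
  (T <= T')%O \/ (T' <= T)%O.
Proof.
case: T => [B|d|]; last by right; exact: le_Infty.
- case: T' => [B'|d'|]; last by left; exact: le_Infty.
  + case: S => [B0|d0|] /le_P1E/= h /le_P1E/= h' //.
      have [a B0a _] := is_cdiskP v_nontrivial (svalP B0).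
      have := cdisk_total v_nontrivial (svalP B) (svalP B') (h _ B0a)
        (h' _ B0a).
      by case=> ?; [left|right]; apply/le_P1E.
    case: h h' => [n h] [m h'].
    have [a Da _] := is_cdiskP v_nontrivial
      (nested_is_cdisk (repr d0) (maxn n m)).
    have Ba : sval B a by apply: h; apply: nested_le Da; exact: leq_maxl.
    have B'a : sval B' a by apply: h'; apply: nested_le Da; exact: leq_maxr.
    have := cdisk_total v_nontrivial (svalP B) (svalP B') Ba B'a.
    by case=> ?; [left|right]; apply/le_P1E.
  + case: S => [B0|d0|] h /le_P1E//= h'.
    by right; rewrite -h'.
- case: S => [B0|d0|] /le_P1E//= -> h'.
  by left.
Qed.

(* This reduces least upper bounds of incomparable points, possibly of type IV,
   to those of two disjoint disks. *)
Lemma incomparable_disks S T : ~ (S <= T)%O -> ~ (T <= S)%O ->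
  exists B B', [/\ (S <= Disk B)%O, (T <= Disk B')%O & sval B `&` sval B' =
    set0].
Proof.
move=> ST TS.
case: S T ST TS => [B|d|] [B'|d'|] ST TS;
  try by [case: ST; exact: le_Infty | case: TS; exact: le_Infty].
- exists B, B'; split => //; apply: contrapT => /eqP/set0P[a [Ba B'a]].
  have [h|h] := cdisk_total v_nontrivial (svalP B) (svalP B') Ba B'a.
    by apply: ST; apply/le_P1E.
  by apply: TS; apply/le_P1E.
- have [[n h]|[n h]] := nested_comparable (repr d') (svalP B).
    by case: TS; apply/le_P1E; exists n.
  exists B, (exist _ _ (nested_is_cdisk (repr d') n)); split => //.
    by apply/le_P1E; exists n.
  by rewrite setIC.
- have [[n h]|[n h]] := nested_comparable (repr d) (svalP B').
    by case: ST; apply/le_P1E; exists n.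
  exists (exist _ _ (nested_is_cdisk (repr d) n)), B'; split => //.
  by apply/le_P1E; exists n.
- have [[n [m h]]|h] := pselect (exists n m,
      (repr d : nested_disks v) n `&` (repr d' : nested_disks v) m = set0).
    exists (exist _ _ (nested_is_cdisk (repr d) n)).
    exists (exist _ _ (nested_is_cdisk (repr d') m)); split => //.
      by apply/le_P1E; exists n.
    by apply/le_P1E; exists m.
  (* If all terms of the two sequences meet, each sequence is finer than the other, so the two type
     IV points are equal. *)
  case: ST; apply/le_P1E => /=; rewrite -(reprK d) -(reprK d').
  apply/eqquotP/asboolP; split=> n.
    have [[m hm]|[m hm]] := nested_comparable (repr d)
      (nested_is_cdisk (repr d') n).
      by exists m.
    by case: h; exists m, n.
  have [[m hm]|[m hm]] := nested_comparable (repr d')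
    (nested_is_cdisk (repr d) n).
    by exists m.
  by case: h; exists n, m; rewrite setIC.
Qed.

Lemma supremums_exist S T : exists W, supremums [set S; T] W.
Proof.
have sup2 W : (S <= W)%O -> (T <= W)%O ->
    (forall U, (S <= U)%O -> (T <= U)%O -> (W <= U)%O) ->
      supremums [set S; T] W.
  move=> SW TW h; split=> [_ [->|->]//|U hU]; apply: h; apply: hU;
    [by left|by right].
have [ST|ST] := pselect (S <= T)%O; first by exists T; apply: sup2.
have [TS|TS] := pselect (T <= S)%O; first by exists S; apply: sup2.
have [B [B' [SB TB' BB']]] := incomparable_disks ST TS.
have [a Ba Bar] := is_cdiskP v_nontrivial (svalP B).
have [b B'b B'br] := is_cdiskP v_nontrivial (svalP B').
have disj z : sval B z -> sval B' z -> False.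
  by move=> Bz B'z; suff : (sval B `&` sval B') z by rewrite BB'.
have rB : radius v (sval B) <= v (b - a).
  rewrite leNgt; apply/negP => /ltW h; apply: disj B'b.
  by rewrite Bar.
have rB' : radius v (sval B') <= v (b - a).
  rewrite leNgt; apply/negP => /ltW h; apply: disj Ba _.
  by rewrite B'br /cdisk/= absval_subC.
(* Disjointness bounds both radii by [v (b - a)], so this disk contains [B] and [B']; every disk
   containing [a] and [b] contains it. *)
pose W : P1 v := Disk (exist _ _ (is_cdisk_cdisk v a (absval_ge0 v (b - a)))).
have BW : (Disk B <= W)%O.
  apply/le_P1E => /=; rewrite Bar; apply: cdisk_subset => //.
  by apply: cdisk_center; exact: absval_ge0.
have B'W : (Disk B' <= W)%O.
  by apply/le_P1E => /=; rewrite B'br; apply: cdisk_subset => //;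
    rewrite /cdisk/=.
exists W; apply: sup2; [exact: le_trans BW|exact: le_trans B'W|move=> U SU TU].
(* Otherwise [U], and with it [T], lies below [Disk B]; then [B] and [B'] are both above [T], hence
   nested, although disjoint. *)
have BU : (Disk B <= U)%O.
  have [//|UB] := le_total_above SB SU.
  have [/le_P1E h|/le_P1E h] := le_total_above (le_trans TU UB) TB'.
    by case: (disj a) => //; exact: h.
  by case: (disj b) => //; exact: h.
have B'U : (Disk B' <= U)%O.
  have [//|UB] := le_total_above TB' TU.
  have [/le_P1E h|/le_P1E h] := le_total_above (le_trans SU UB) SB.
    by case: (disj b) => //; exact: h.
  by case: (disj a) => //; exact: h.
case: U BU B'U {SU TU} => [B0|d|] /le_P1E//= h /le_P1E//= h';
  apply/le_P1E => //=.
have B0a := h _ Ba; have B0b := h' _ B'b.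
rewrite (cdisk_in v_nontrivial (svalP B0) B0a) in B0b *.
by apply: cdisk_subset => //; apply: cdisk_center; exact: radius_ge0 (svalP B0).
Qed.

(** [lub] is chosen among the suprema, with default [Infty]; existence rules the default out. *)
Lemma supremums_lub S T : supremums [set S; T] (lub S T).
Proof.
have [W hW] := supremums_exist S T; rewrite /lub /supremum ifF.
  by apply: xgetPex; exists W.
by apply/negbTE/set0P; exists S; left.
Qed.

Lemma le_lubl S T : (S <= lub S T)%O.
Proof. by have [h _] := supremums_lub S T; apply: h; left. Qed.

Lemma le_lubr S T : (T <= lub S T)%O.
Proof. by have [h _] := supremums_lub S T; apply: h; right. Qed.

Lemma lub_le S T W : (S <= W)%O -> (T <= W)%O -> (lub S T <= W)%O.
Proof.
by move=> SW TW; have [_ h] := supremums_lub S T; apply: h => _ [->|->].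
Qed.

Lemma lubC S T : lub S T = lub T S.
Proof. by rewrite /lub setUC. Qed.

(** * Diameters along the tree order *)

Lemma nested_radius_cvg D : (radius v (D n)) @[n --> \oo] -->
  inf (range (fun n => radius v (D n))).
Proof.
apply: nonincreasing_cvgn.
  by move=> n m nm; apply: radius_le => //;
    [exact: nested_is_cdisk..|exact: nested_le].
by exists 0 => _ [n _ <-]; apply: radius_ge0 => //; exact: nested_is_cdisk.
Qed.

Lemma nested_lim_le D n :
  lim (radius v (D n) @[n --> \oo]) <= radius v (D n).
Proof.
rewrite (cvg_lim _ (@nested_radius_cvg D))//; apply: ge_inf; last by exists n.
by exists 0 => _ [m _ <-]; apply: radius_ge0 => //; exact: nested_is_cdisk.
Qed.

Lemma nested_lim_ge0 D : 0 <= lim (radius v (D n) @[n --> \oo]).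
Proof.
rewrite (cvg_lim _ (@nested_radius_cvg D))//; apply: lb_le_inf.
  by exists (radius v (D 0%N)), 0%N.
by move=> _ [m _ <-]; apply: radius_ge0 => //; exact: nested_is_cdisk.
Qed.

(** Beyond each index some disk is strictly smaller, hence of strictly smaller radius, because
    nested disks of equal radius coincide. *)
Lemma nested_lim_lt D n :
  lim (radius v (D n) @[n --> \oo]) < radius v (D n).
Proof.
have [m hm] := nested_not_subset D (nested_is_cdisk D n).
apply: le_lt_trans (nested_lim_le D m) _; rewrite ltNge; apply/negP => rnm.
have [h|h] := leqP n m; last by apply: hm; apply: nested_le; exact: ltnW.
by apply: hm; rewrite
  (cdisk_eq v_nontrivial (nested_is_cdisk D m) (nested_is_cdisk D n))//;
    exact: nested_le.
Qed.

Lemma nested_radius_lt D e : lim (radius v (D n) @[n --> \oo]) < e ->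
  exists n, radius v (D n) < e.
Proof.
rewrite (cvg_lim _ (@nested_radius_cvg D))// => /inf_lt[|_ [n _ <-] ne];
  last by exists n.
by exists (radius v (D 0%N)), 0%N.
Qed.

Lemma diam_ge0 S : (0 <= diam S)%E.
Proof.
by case: S => [B|d|]//=; rewrite lee_fin;
  [exact: radius_ge0 (svalP B)|exact: nested_lim_ge0].
Qed.

Lemma diam_lt S T : (S < T)%O -> (diam S < diam T)%E.
Proof.
rewrite lt_neqAle => /andP[ST /le_P1E].
case: S T ST => [B|d|] [B'|d'|] ST //= h.
- rewrite lte_fin ltNge; apply: contraNN ST => r; apply/eqP; congr Disk.
  have := cdisk_eq v_nontrivial (svalP B) (svalP B') h r.
  by case: B B' {h r} => [B dB] [B' dB'] /= h; exact: eq_exist.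
- by rewrite ltry.
- case: h => n h; rewrite lte_fin (lt_le_trans (nested_lim_lt (repr d) n))//.
  by apply: radius_le => //; [exact: nested_is_cdisk|exact: svalP].
- by rewrite h eqxx in ST.
- by rewrite ltry.
- by rewrite eqxx in ST.
Qed.

Lemma le_diam S T : (S <= T)%O -> (diam S <= diam T)%E.
Proof. by rewrite le_eqVlt => /predU1P[->//|/diam_lt/ltW]. Qed.

Lemma diam_fineK S : S <> Infty v -> ((fine (diam S))%:E = diam S)%E.
Proof. by case: S. Qed.

(** On the chain of points above [S], the diameter decides the order. *)
Lemma le_diam_above S T T' : (S <= T)%O -> (S <= T')%O ->
  (diam T <= diam T')%E -> (T <= T')%O.
Proof.
move=> ST ST' TT'; have [//|] := le_total_above ST ST'.
rewrite le_eqVlt => /predU1P[->//|/diam_lt]; by rewrite ltNge TT'.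
Qed.

Lemma lt_diam_above S T T' : (S <= T)%O -> (S <= T')%O ->
  (diam T < diam T')%E -> (T < T')%O.
Proof.
move=> ST ST' TT'; rewrite lt_neqAle (le_diam_above ST ST') ?ltW// andbT.
by apply: contraTneq TT' => ->; rewrite ltxx.
Qed.

(** The disk form of [T] is claimed only when [S < T]: a type IV point of diameter [r] is its own
    [T]. This form identifies [T] as type II when [r] is the absolute value of a nonzero element. *)
Lemma exists_above S (r : R) : (diam S <= r%:E)%E ->
  exists T, [/\ (S <= T)%O, diam T = r%:E & (S < T)%O ->
    exists a, exists d : is_cdisk v (cdisk v a r), T = Disk (exist _ _ d)].
Proof.
have disk B : is_cdisk v B -> radius v B <= r ->
  exists a (d : is_cdisk v (cdisk v a r)), B `<=` cdisk v a r.
  move=> dB Br; have [a Ba Bar] := is_cdiskP v_nontrivial dB.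
  have r0 : 0 <= r by apply: le_trans Br; exact: radius_ge0.
  exists a, (is_cdisk_cdisk v a r0).
  by rewrite Bar; apply: cdisk_subset => //; exact: cdisk_center.
have diamD a (d : is_cdisk v (cdisk v a r)) : diam (Disk (exist _ _ d)) = r%:E.
  rewrite /= radius_cdisk//; case: d => b [s [s0 ab]].
  have : cdisk v a r b by rewrite ab; exact: cdisk_center.
  by apply: le_trans; exact: absval_ge0.
case: S => [B|d|]//; rewrite lee_fin.
  move=> /(disk _ (svalP B))[a [d aB]]; exists (Disk (exist _ _ d)).
  by split => //; [exact/le_P1E|exists a, d].
rewrite le_eqVlt => /predU1P[r_eq|/nested_radius_lt[n nr]].
  by exists (TypeIV d); split => //=; rewrite ?r_eq// ltxx.
have [a [d' aB]] := disk _ (nested_is_cdisk (repr d) n) (ltW nr).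
by exists (Disk (exist _ _ d')); split => //;
  [apply/le_P1E; exists n|exists a, d'].
Qed.

Lemma typeII_between S (a : R) (b : \bar R) : (diam S <= a%:E)%E ->
  (a%:E < b)%E ->
  exists Q, [/\ (S < Q)%O, typeII Q, (a%:E < diam Q)%E & (diam Q < b)%E].
Proof.
move=> Sa ab.
have a0 : 0 <= a by rewrite -lee_fin; apply: le_trans Sa; exact: diam_ge0.
have [c ac cb] : exists2 c : R, a < c & (c%:E <= b)%E.
  case: b ab => [b|_|]//; first by rewrite lte_fin; exists b.
  by exists (a + 1); rewrite ?leey ?ltrDl.
have [z z0 /andP[az zc]] := absval_dense v_nontrivial a0 ac.
have Sz : (diam S < (v z)%:E)%E by apply: le_lt_trans Sa _; rewrite lte_fin.
have [T [ST Tz TD]] := exists_above (ltW Sz).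
have {}ST : (S < T)%O by apply: lt_diam_above ST _ => //; rewrite Tz.
exists T; split => //; rewrite ?Tz ?lte_fin//.
- by have [e [d ->]] := TD ST; exists e, z.
- by apply: lt_le_trans cb; rewrite lte_fin.
Qed.

Lemma typeII_diam Q : typeII Q -> Q <> Infty v /\ (0 < diam Q)%E.
Proof.
case: Q => // B /= [a [z [z0 Bz]]]; split => //=.
by rewrite Bz (radius_cdisk v_nontrivial a (absval_ge0 v z)) lte_fin absval_gt0.
Qed.

Lemma diam_H1 S : (0 < diam S)%E -> S <> Infty v -> H1 S.
Proof.
case: S => [B|d|] S0 Soo; rewrite /H1//=.
case=> a Ba; move: S0 => /=.
by rewrite Ba (radius_cdisk v_nontrivial a (lexx 0)) ltxx.
Qed.

Lemma H1_neq_Infty S : H1 S -> S <> Infty v.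
Proof. by rewrite /H1/= => h S_oo; apply: h; rewrite S_oo. Qed.

End Tree.

(** * The Hsia kernel and the weak topology *)

Section Topology.
Context {R : realType} {K : closedFieldType} (v : nonarch_absval R K).
Hypothesis v_nontrivial : nontrivial v.
Implicit Types (S T P Q W : P1 v).

Lemma hsiaC S T : hsia S T = hsia T S.
Proof. by rewrite /hsia lubC. Qed.

Lemma diam_le_hsia S T : (diam S <= hsia S T)%E.
Proof. exact/le_diam/le_lubl. Qed.

Lemma hsia_ge0 S T : (0 <= hsia S T)%E.
Proof. exact: diam_ge0. Qed.

Lemma hsiaxx S : hsia S S = diam S.
Proof.
congr diam; apply/eqP; rewrite eq_le le_lubl// andbT.
exact: lub_le.
Qed.

Lemma hsia_le S T W : (S <= W)%O -> (T <= W)%O -> (hsia S T <= diam W)%E.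
Proof. by move=> SW TW; apply/le_diam => //; exact: lub_le. Qed.

Lemma hsia_ultra S T W : (hsia S T <= maxe (hsia S W) (hsia W T))%E.
Proof.
have := le_total_above v_nontrivial (le_lubr v_nontrivial S W)
  (le_lubl v_nontrivial W T).
rewrite le_max; case=> h; apply/orP; [right|left]; apply: hsia_le.
- exact: le_trans (le_lubl v_nontrivial S W) h.
- exact: le_lubr.
- exact: le_lubl.
- exact: le_trans (le_lubr v_nontrivial W T) h.
Qed.

(** [lub T S] and [Q] both lie above [S], so they are comparable and their diameters tell which is
    larger. *)
Lemma le_above_hsia S T Q : (S <= Q)%O ->
  (T <= Q)%O <-> (hsia T S <= diam Q)%E.
Proof.
move=> SQ; split=> [TQ|h]; first exact: hsia_le.
apply: le_trans (le_lubl v_nontrivial T S) _.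
exact: (le_diam_above v_nontrivial (le_lubr v_nontrivial T S)).
Qed.

Lemma lt_above_hsia S T Q : (S <= Q)%O ->
  (lub T S < Q)%O <-> (hsia T S < diam Q)%E.
Proof.
move=> SQ; split=> [TQ|h]; first exact: diam_lt.
exact: (lt_diam_above v_nontrivial (le_lubr v_nontrivial T S)).
Qed.

(** * Directions at a point *)

Lemma lub_id S T : (T <= S)%O -> lub S T = S.
Proof.
by move=> TS; apply/eqP; rewrite eq_le le_lubl// lub_le.
Qed.

Lemma oseg_refl S T : T <> S -> oseg S T T.
Proof. by move=> TS; split=> //; right; rewrite /= lexx le_lubr. Qed.

(** All points not below [Q] are seen from [Q] in one upward direction, because the points above [Q]
    form a chain. *)
Lemma Udir_up Q P : ~ (P <= Q)%O -> Udir Q P = [set T | ~ (T <= Q)%O].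
Proof.
move=> PQ; apply/seteqP; split=> T /=.
  move=> [TQ [T0 [T0Q sub]]] leTQ.
  have [[hP _] [hT _]] := sub _ (oseg_refl T0Q).
  have leT0 : (T0 <= Q)%O.
    by move: hT; rewrite /seg (lub_id leTQ) => -[] /= /andP[].
  case: hP => /= /andP[h _]; last by apply: PQ; exact: le_trans leT0.
  by apply: T0Q; apply/eqP; rewrite eq_le leT0.
move=> TQ; split=> [TQE|]; first by apply: TQ; rewrite TQE.
(* Applied with [lub Q X] the lower of the two joins: up to it, the paths from [Q] to [X] and to [Y]
   coincide. *)
have key X Y : ~ (X <= Q)%O -> (lub Q X <= lub Q Y)%O ->
    oseg Q (lub Q X) `<=` oseg Q X `&` oseg Q Y.
  move=> XQ XY Z [ZZ ZQ].
  have {ZZ} /andP[QZ ZX] : (Q <= Z <= lub Q X)%O.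
    have lE : lub Q (lub Q X) = lub Q X.
      by rewrite lubC; apply: lub_id; exact: le_lubl.
    case: ZZ => /=; rewrite lE => /andP[h1 h2].
      by rewrite h1.
    by rewrite h2 (le_trans _ h1)// le_lubl.
  by split; split => //; left; rewrite /= QZ// (le_trans ZX).
have lubQ X : ~ (X <= Q)%O -> lub Q X <> Q.
  by move=> XQ h; apply: XQ; rewrite -h le_lubr.
have := le_total_above v_nontrivial (le_lubl v_nontrivial Q P)
  (le_lubl v_nontrivial Q T).
case=> h; [exists (lub Q P)|exists (lub Q T)]; split; try exact: lubQ.
  exact: key.
by rewrite setIC; exact: key.
Qed.

(** Two paths descending from [Q] have the same germ exactly when they part strictly below [Q], that
    is, at a join smaller than [Q]. *)
Lemma Udir_down Q P : (P < Q)%O -> Udir Q P = [set T | (lub T P < Q)%O].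
Proof.
move=> PQ.
have down X : (X < Q)%O -> oseg Q X = [set Z | (X <= Z < Q)%O].
  move=> XQ; apply/seteqP; split=> Z.
    move=> [+ /eqP ZQ]; rewrite /seg lub_id ?ltW// => -[] /= /andP[h1 h2].
      by case/negP: ZQ; rewrite eq_le h1 h2.
    by rewrite h1 lt_neqAle ZQ.
  move=> /= /andP[XZ ZQ]; split; last by move=> ZE; rewrite ZE ltxx in ZQ.
  by right; rewrite /= XZ lub_id ?ltW.
apply/seteqP; split=> T /=; last first.
  move=> TPQ; have TQ : (T < Q)%O := le_lt_trans (le_lubl v_nontrivial T P) TPQ.
  split; first by move=> TE; rewrite TE ltxx in TQ.
  exists (lub T P); split; first by move=> lE; rewrite lE ltxx in TPQ.
  rewrite !down// => Z /= /andP[lZ ZQ].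
  by rewrite ZQ !(le_trans _ lZ)// ?le_lubl ?le_lubr.
move=> [TQ [T0 [T0Q sub]]].
have [] := sub _ (oseg_refl T0Q).
rewrite down// => /= /andP[PT0 T0ltQ] [[]] /= /andP[h1 h2] _.
  by rewrite (lt_geF T0ltQ) in h1.
by apply: le_lt_trans T0ltQ; exact: lub_le.
Qed.

(** The path from [y] to [T] climbs only to their join, of diameter less than [diam Q], so it avoids
    [Q] and stays in one direction. *)
Lemma Udir_hsia Q P y T : P <> Q -> Udir Q P y -> (hsia T y < diam Q)%E ->
  Udir Q P T.
Proof.
move=> PQ; have [PleQ|PnQ] := pselect (P <= Q)%O; last first.
  rewrite Udir_up//= => yQ Ty TQ; apply: yQ.
  apply: le_trans (le_lubr v_nontrivial T y) _.
  exact: (le_diam_above v_nontrivial (le_lubl v_nontrivial T y) TQ (ltW Ty)).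
have {PQ}PleQ : (P < Q)%O by rewrite lt_neqAle PleQ andbT; exact/eqP.
rewrite Udir_down//= => yPQ Ty.
have yQ : (y <= Q)%O := le_trans (le_lubl v_nontrivial y P) (ltW yPQ).
apply/(lt_above_hsia _ (ltW PleQ)); apply: le_lt_trans (hsia_ultra T P y) _.
by rewrite gt_max Ty (diam_lt v_nontrivial yPQ).
Qed.

(** * The weak topology *)

Lemma open_Udir Q P : typeII Q -> P <> Q -> open (Udir Q P).
Proof.
move=> Q2 PQ; exists [set Udir Q P]; last by rewrite bigcup_set1.
by move=> _ ->; apply: (@finI_from1 _ _ _ _ (Q, P)).
Qed.

Lemma open_notle Q : typeII Q -> open [set T | ~ (T <= Q)%O].
Proof.
move=> Q2; have [Qoo _] := typeII_diam v_nontrivial Q2.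
rewrite -(@Udir_up Q (Infty v)); last by move=> /Infty_le.
by apply: open_Udir => // /esym.
Qed.

Lemma open_subbaseP (U : set (P1 v)) y : open U -> U y ->
  exists s : seq (P1 v * P1 v),
    (forall p, p \in s -> [/\ typeII p.1, p.2 <> p.1 & Udir p.1 p.2 y]) /\
    (forall T, (forall p, p \in s -> Udir p.1 p.2 T) -> U T).
Proof.
case=> D' sD <- [A D'A Ay]; have [F FD AE] := sD _ D'A.
exists (F : {fset P1 v * P1 v}); split=> [p pF|T hT].
  have [p2 p12] : typeII p.1 /\ p.2 <> p.1 by have /set_mem := FD _ pF.
  by split => //; have {}Ay : A y := Ay; move: Ay; rewrite -AE; exact.
exists A => //; change (A T); rewrite -AE => p pF; exact: hT.
Qed.

(* The Hsia kernel topology, with isolated points of positive diameter, is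
   finer than the weak topology. *)
Lemma open_hsia_nbhd (U : set (P1 v)) y : open U -> U y ->
  exists2 e : R, 0 < e & forall T, (hsia T y <= e%:E)%E -> U T.
Proof.
move=> oU Uy; have [s [sy sU]] := open_subbaseP oU Uy.
have [e e0 es] : exists2 e : R, 0 < e &
    forall p, p \in s -> (e%:E < diam p.1)%E.
  elim: s sy {sU} => [|p s IH] ps; first by exists 1.
  have [|e e0 es] := IH; first by move=> q qs; apply: ps; rewrite inE qs orbT.
  have [p2 _ _] := ps p (mem_head _ _).
  have [poo p0] := typeII_diam v_nontrivial p2.
  have dp := diam_fineK poo.
  have fp : 0 < fine (diam p.1) by rewrite -lte_fin dp.
  exists (Num.min e (fine (diam p.1) / 2)); first by rewrite lt_min e0 divr_gt0.
  move=> q; rewrite inE => /predU1P[->|/es]; last first.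
    by apply: le_lt_trans; rewrite lee_fin ge_min lexx.
  by rewrite -dp lte_fin gt_min; apply/orP; right; lra.
exists e => // T Ty; apply: sU => p ps; have [_ p12 py] := sy _ ps.
exact: (Udir_hsia p12 py) (le_lt_trans Ty (es _ ps)).
Qed.

(** Of two distinct points, one, [y], is not below the other, [x]. A type II point [Q] strictly
    between [x] and [lub x y] in diameter sees [x] downwards and [y] upwards. *)
Lemma hausdorff_P1 : hausdorff_space (P1 v).
Proof.
have sep x y : ~ (y <= x)%O -> exists A B : set (P1 v),
    [/\ open A, open B, A x, B y & A `&` B = set0].
  move=> yx; have xW : (x < lub x y)%O.
    rewrite lt_neqAle le_lubl// andbT; apply/eqP => xE; apply: yx.
    by rewrite xE le_lubr.
  have xoo : x <> Infty v by move=> xE; apply: yx; rewrite xE le_Infty.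
  have xr : (diam x <= (fine (diam x))%:E)%E by rewrite diam_fineK.
  have rW : ((fine (diam x))%:E < hsia x y)%E by rewrite diam_fineK//;
    exact: diam_lt.
  have [Q [xQ Q2 Qx QW]] := typeII_between v_nontrivial xr rW.
  exists (Udir Q x), [set T | ~ (T <= Q)%O]; split.
  - by apply: open_Udir => // xE; rewrite xE ltxx in xQ.
  - exact: open_notle.
  - rewrite Udir_down//=; apply/(lt_above_hsia _ (ltW xQ)).
    by rewrite hsiaxx diam_lt.
  - rewrite /= => yQ; have := hsia_le (ltW xQ) yQ; by rewrite leNgt QW.
  - rewrite Udir_down//; apply/seteqP; split=> // T [/= TQ]; apply.
    exact: le_trans (le_lubl v_nontrivial T x) (ltW TQ).
rewrite open_hausdorff => x y xy.
have [yx|yx] := pselect (y <= x)%O.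
  have [|A [B [oA oB Ax By AB]]] := sep y x.
    by move=> xley; move/eqP: xy; apply; apply/eqP; rewrite eq_le xley.
  exists (B, A); first by split; exact: mem_set.
  by split=> //=; rewrite setIC AB.
have [A [B [oA oB Ax By AB]]] := sep x y yx.
exists (A, B); first by split; exact: mem_set.
by split=> //=; rewrite AB.
Qed.

(** The ball is empty if [r < diam S]. Otherwise a type II point [Q] above [S], with diameter
    between [r] and [hsia T S], has the ball below it and [T] not below it. *)
Lemma closed_ballP1 S (r : R) : closed (ballP1 S r).
Proof.
rewrite -[ballP1 S r]setCK closedC openE => T /= nT.
have [Sr|Sr] := leP (diam S) r%:E; last first.
  suff -> : ~` ballP1 S r = setT by exact: filterT.
  apply/seteqP; split=> // Z _ [_]; apply/negP; rewrite -ltNge.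
  by apply: lt_le_trans Sr _; rewrite hsiaC; exact: diam_le_hsia.
have rT : (r%:E < hsia T S)%E.
  rewrite ltNge; apply/negP => Tr; apply: nT; split => // TE.
  have := le_lubl v_nontrivial T S; move: Tr.
  by rewrite /hsia TE => + /Infty_le => /[swap] ->.
have [Q [SQ Q2 Qr QT]] := typeII_between v_nontrivial Sr rT.
have TQ : ~ (T <= Q)%O.
  by move=> TQ; have := hsia_le TQ (ltW SQ); rewrite leNgt QT.
apply: filterS (open_nbhs_nbhs (conj (open_notle Q2) TQ)) => Z /= ZQ [_ Zr].
by apply: ZQ; apply/(le_above_hsia _ (ltW SQ)); exact: le_trans Zr (ltW Qr).
Qed.

End Topology.

(** * Lower density implies bounded moduli *)

(* MathComp's integral is a difference of lower integrals, hence monotone on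
   all functions. *)
Lemma le_integral_nonmeas d (T : measurableType d) (R : realType)
    (mu : {measure set T -> \bar R}) (f g : T -> \bar R) :
  (forall x, f x <= g x)%E -> (\int[mu]_x f x <= \int[mu]_x g x)%E.
Proof.
move=> fg; rewrite /integral !patch_setT.
apply: leeB; apply: le_ereal_sup => _ [h hf <-]; exists h => // x;
  apply: le_trans (hf x) _.
- by apply: (@funepos_le _ _ setT); rewrite ?inE.
- by apply: (@funeneg_le _ _ setT); rewrite ?inE.
Qed.

(** [f] is not assumed measurable; it is dominated by the measurable [g], equal to [c] on [C] and to
    [+oo] on the null set outside. *)
Lemma prob_integral_le d (T : measurableType d) (R : realType)
    (P : probability T R) (C : set T) (f : T -> \bar R) (c : R) :
  measurable C -> P (~` C) = 0%E -> (forall x, C x -> f x <= c%:E)%E ->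
  (\int[P]_x f x <= c%:E)%E.
Proof.
move=> mC PC fc.
pose g x : \bar R := (c%:E + (cst +oo%E \_ (~` C)) x)%E.
have mg : measurable_fun setT g.
  apply: emeasurable_funD; first exact: measurable_cst.
  apply/(measurable_restrictT _ _).1; first exact: measurableC.
  exact: measurable_cst.
apply: (@le_trans _ _ (\int[P]_x g x)%E).
  apply: le_integral_nonmeas => x; rewrite /g patchE.
  case: ifPn; rewrite ?inE ?notin_setE => Cx; first by rewrite leey.
  by rewrite adde0; apply: fc; apply: contrapT.
rewrite (@ae_eq_integral _ _ _ P setT (cst c%:E))//.
  by rewrite integral_cst//= probability_setT mule1.
exists (~` C); split; [exact: measurableC|by []|].
move=> x; apply: contra_not => Cx _ /=; rewrite /g patchE ifF ?adde0//.
by apply/negbTE; rewrite notin_setE => nCx; exact: nCx Cx.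
Qed.

(** The subtracted series has integral at most [b] times the sum of the [2^-n], which is [2 * b]. *)
Lemma prob_integral_ge d (T : measurableType d) (R : realType)
    (P : probability T R) (M : nat -> set T) (f : T -> \bar R) (a b : R) :
  0 <= b -> (forall n, measurable (M n)) ->
  (forall n, P (M n) <= ((2^-1) ^+ n)%:E)%E ->
  (forall x, a%:E - \sum_(0 <= n <oo) (b * \1_(M n) x)%:E <= f x)%E ->
  ((a - 2 * b)%:E <= \int[P]_x f x)%E.
Proof.
move=> b0 mM PM fG.
pose G x := (\sum_(0 <= n <oo) (b * \1_(M n) x)%:E)%E.
have g0 n x : (0 <= (b * \1_(M n) x)%:E)%E by rewrite lee_fin mulr_ge0// indicE.
have mg n : measurable_fun setT (fun x => (b * \1_(M n) x)%:E).
  apply/measurable_EFinP; apply: measurable_funM => //.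
have G0 x : (0 <= G x)%E by apply: nneseries_ge0 => n _ _; exact: g0.
have mG : measurable_fun setT G.
  by apply: ge0_emeasurable_sum => // n x _ _; exact: g0.
have iG : (\int[P]_x G x <= (2 * b)%:E)%E.
  rewrite integral_nneseries//.
  have cvg2 : (\sum_(0 <= n <oo) (b * (2^-1) ^+ n)%:E)%E = (2 * b)%:E.
    have -> : (2 * b)%:E = (b * (1 - 2^-1)^-1)%:E.
      have -> : 1 - 2^-1 = (2^-1 : R) by lra.
      by rewrite invrK mulrC.
    apply/cvg_lim => //.
    rewrite (_ : (fun n => _) = EFin \o series (geometric b 2^-1)); last first.
      by apply/funext => n /=; rewrite sumEFin.
    apply/fine_cvgP; split; first exact: nearW.
    by apply: cvg_geometric_series; rewrite ger0_norm ?invr_ge0// invf_lt1//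
      ltr1n.
  rewrite -cvg2; apply: lee_nneseries => [n _|n _].
    by rewrite integral_ge0// => x _; exact: g0.
  under eq_integral do rewrite EFinM.
  rewrite ge0_integralZl//; last by apply/measurable_EFinP;
    exact: measurable_indic.
  by rewrite integral_indic// setIT EFinM; apply: lee_wpmul2l;
    [rewrite lee_fin|exact: PM].
have intG : P.-integrable setT G.
  apply/integrableP; split => //.
  under eq_integral do rewrite gee0_abs//.
  exact: le_lt_trans iG (ltry _).
apply: le_trans (le_integral_nonmeas _ fG).
have ia : P.-integrable setT (cst a%:E).
  exact: finite_measure_integrable_cst.
rewrite (@integralB _ _ _ P _ measurableT (cst a%:E) G)// integral_cst//=
  probability_setT mule1.
by rewrite EFinB leeB.
Qed.

(** * Upper bounds on capacities and moduli *)

Section Capacity.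
Context {R : realType} {K : closedFieldType} (v : nonarch_absval R K).
Hypothesis v_nontrivial : nontrivial v.
Implicit Types (S T : P1 v) (C E : set (P1 v)).

Lemma open_measurable_P1 C : open C -> measurable (C : set (borelP1 v)).
Proof. by move=> oC; apply: sub_sigma_algebra. Qed.

Lemma closed_measurable_P1 C : closed C -> measurable (C : set (borelP1 v)).
Proof.
move=> cC; rewrite -[C]setCK; apply: measurableC; apply: open_measurable_P1.
exact: closed_openC.
Qed.

Lemma capacity_le C (d : R) : compact C -> 0 < d ->
  (forall S T, C S -> C T -> hsia S T <= d%:E)%E -> (capacity C <= d%:E)%E.
Proof.
move=> cC d0 Cd.
have mC : measurable (C : set (borelP1 v)).
  by apply: closed_measurable_P1; apply: compact_closed => //;
    exact: hausdorff_P1.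
have dE : expeR (lne d%:E) = d%:E.
  by rewrite lneK// in_itv/= leey andbT lee_fin ltW.
rewrite /capacity -dE lee_expeR lne_EFin//;
  apply: ge_ereal_sup => _ [nu [_ nuC] <-].
apply: (prob_integral_le mC nuC) => S CS.
apply: (prob_integral_le mC nuC) => T CT.
by rewrite -lne_EFin// lee_lne ?Cd// in_itv/= ?leey ?hsia_ge0// lee_fin ltW.
Qed.

Lemma lower_capacity_bounded_moduli E : compact E ->
  lower_capacity_density E -> bounded_moduli E.
Proof.
move=> cE [c [/andP[c0 c1] Ec]].
suff sup_le : forall S S', separating_annulus E S S' -> modulus S S' <= - ln c.
  apply: (@le_lt_trans _ _ (- ln c)%:E); last exact: ltry.
  apply: ge_ereal_sup => _ [->|[[S S'] /= h <-]].
    by rewrite lee_fin oppr_ge0 ln_le0// ltW.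
  by rewrite lee_fin sup_le.
move=> S S' [[HS HS' SS'] [AE [T [ET TS]] [T' [ET' TS']]]].
have {}TS : (T <= S)%O.
  move: TS; rewrite Udir_up//=; first exact: contrapT.
  by move=> h; rewrite (lt_geF SS') in h.
have {TS'} : ~ (hsia T' S < diam S')%E.
  by move=> /(lt_above_hsia v_nontrivial _ (ltW SS')) h; apply: TS';
    rewrite Udir_down.
have Soo := H1_neq_Infty HS; have S'oo := H1_neq_Infty HS'.
have dS := diam_fineK Soo; have dS' := diam_fineK S'oo.
set d1 := fine (diam S) in dS *; set d2 := fine (diam S') in dS' *.
have d10 : 0 <= d1 by rewrite -lee_fin dS diam_ge0.
have d12 : d1 < d2 by rewrite -lte_fin dS dS' diam_lt.
move=> T'S.
have TS' : (T < S')%O := le_lt_trans TS SS'.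
have TT' : (d2%:E <= hsia T T')%E.
  rewrite dS' leNgt; apply/negP => h; apply: T'S.
  apply: le_lt_trans (hsia_ultra v_nontrivial T' S T) _.
  rewrite hsiaC gt_max h/= (le_lt_trans (hsia_le v_nontrivial TS (lexx S)))//.
  by rewrite diam_lt.
(* Every [r] between [d1] and [d2] is admissible in the density property, since [T] and [T'] are
   points of [E] at least [d2] apart. *)
have key r : d1 < r -> r < d2 ->
  (((c * r)%:E : \bar R) <= capacity (E `&` ballP1 T r))%E.
  move=> d1r rd2; apply: Ec => //.
  - by move=> TE; move: TS; rewrite TE => /Infty_le.
  - by apply: le_lt_trans (le_diam v_nontrivial TS) _; rewrite -dS lte_fin.
  - apply: lt_le_trans (_ : (d2%:E <= _)%E); first by rewrite lte_fin.
    apply: le_trans TT' _; apply: ereal_sup_ubound.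
    by exists T => //; exists T'.
(* The bound [d > d1] is positive by construction; positivity of [d1] itself is only obtained below,
   from [cd2]. *)
have cap r d : d1 < r -> r < d2 -> d1 < d ->
  (capacity (E `&` ballP1 T r) <= d%:E)%E.
  move=> d1r rd2 d1d; apply: capacity_le.
  - apply: compact_closedI => //; exact: closed_ballP1.
  - exact: le_lt_trans d10 d1d.
  have below X : (E `&` ballP1 T r) X -> (X <= S)%O.
    move=> [EX [Xoo XT]]; apply: contrapT => XS; apply: (AE X) => //; split.
      by rewrite Udir_up//= => h; rewrite (lt_geF SS') in h.
    rewrite Udir_down//=; apply/(lt_above_hsia v_nontrivial _ (ltW SS')).
    apply: le_lt_trans (hsia_ultra v_nontrivial X S T) _.
    rewrite gt_max -dS' (le_lt_trans XT) ?lte_fin//=.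
    by rewrite dS' (le_lt_trans (hsia_le v_nontrivial TS (lexx S)))// diam_lt.
  move=> X Y /below XS /below YS.
  by apply: le_trans (hsia_le v_nontrivial XS YS) _; rewrite -dS lee_fin ltW.
have cd2 : c * d2 <= d1.
  rewrite leNgt; apply/negP => lt12.
  (* With [d1 < d < c * d2] and [d / c < r < d2], the two capacity bounds yield
     [c * r <= d < c * r]. *)
  pose d := (d1 + c * d2) / 2.
  have d1d : d1 < d by rewrite /d; lra.
  have dcd2 : d / c < d2 by rewrite ltr_pdivrMr// /d; lra.
  have ddc : d <= d / c.
    by rewrite ler_pdivlMr// ler_piMr ?(ltW c1)// (le_trans d10 (ltW d1d)).
  pose r := (d / c + d2) / 2.
  have d1r : d1 < r by rewrite /r; lra.
  have rd2 : r < d2 by rewrite /r; lra.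
  have := le_trans (key r d1r rd2) (cap r d d1r rd2 d1d).
  rewrite lee_fin leNgt => /negP; apply.
  by rewrite mulrC -ltr_pdivrMr// /r; lra.
have d20 : 0 < d2 := le_lt_trans d10 d12.
have {}d10 : 0 < d1 by apply: lt_le_trans cd2; exact: mulr_gt0.
rewrite /modulus -/d1 -/d2 -lnV ?posrE// ler_ln ?posrE ?invr_gt0 ?divr_gt0//.
by rewrite ler_pdivrMr// ler_pdivlMl.
Qed.

End Capacity.

(** * Bounded moduli imply lower density *)

Section UnitProbability.
Context {R : realType}.

Definition unit_prob : set (measurableTypeR R) -> \bar R :=
  mrestr (@lebesgue_measure R) (measurable_itv `[0%R, 1%R[).

HB.instance Definition _ := Measure.on unit_prob.

Let unit_prob_setT : unit_prob setT = 1%E.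
Proof.
by rewrite /unit_prob /mrestr setTI lebesgue_measure_itv/= lte01 oppr0 adde0.
Qed.

HB.instance Definition _ :=
  Measure_isProbability.Build _ _ _ unit_prob unit_prob_setT.

End UnitProbability.

(** * Radon push-forwards by maps continuous off a countable set *)

Section Pushforward.
Context {R : realType} {K : closedFieldType} (v : nonarch_absval R K).
Hypothesis v_nontrivial : nontrivial v.
Variables (D : set R) (phi : R -> P1 v).
Hypotheses (D_count : countable D).
Hypothesis phi_cont : forall x, ~ D x -> {for x, continuous phi}.

(** The preimage of an open set is its interior together with some points of the countable set
    [D]. *)
Lemma continuous_off_measurable :
  measurable_fun setT (phi : measurableTypeR R -> borelP1 v).
Proof.
apply: (@measurability _ _ _ (borelP1 v) setT phi (@open (P1 v))) =>
  // _ [U oU <-].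
rewrite setTI.
have -> : phi @^-1` U = (phi @^-1` U)^° `|` (phi @^-1` U `&` D).
  apply/seteqP; split=> [x Ux|x [|[]//]]; last exact: interior_subset.
  have [Dx|Dx] := pselect (D x); [by right|left].
  by apply: (phi_cont Dx); exact: open_nbhs_nbhs.
apply: measurableU; first by apply: open_measurable; exact: open_interior.
apply: countable_measurable; first exact: measurable_set1.
by apply: sub_countable D_count; apply: subset_card_le => x [].
Qed.

Let X : {mfun measurableTypeR R >-> borelP1 v} :=
  mfun_Sub (mem_set continuous_off_measurable).

Let nu := distribution unit_prob X.

Let nuE A : nu A = lebesgue_measure (phi @^-1` A `&` `[0%R, 1%R[%classic).
Proof. by []. Qed.

(** As in Lusin's theorem: a compact [V] fills the preimage of [A] up to [e / 2], and an open [U] of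
    measure less than [e / 2] covers [D]. On the compact [V] minus [U] the map is continuous, so the
    image is a compact subset of [A]. *)
Lemma distribution_radon : radon nu.
Proof.
move=> A mA; apply/eqP; rewrite eq_le; apply/andP; split; last first.
  apply: ge_ereal_sup => _ [C [cC CA] <-].
  apply: le_measure; rewrite ?inE//; apply: closed_measurable_P1.
  by apply: compact_closed => //; exact: hausdorff_P1.
apply/lee_addgt0Pr => e e0.
have mX : measurable
  (phi @^-1` A `&` `[0%R, 1%R[%classic : set (measurableTypeR R)).
  apply: measurableI => //; rewrite -[_ @^-1` _]setTI.
  exact: continuous_off_measurable.
have D0 : lebesgue_measure D = 0%E by exact: countable_lebesgue_measure0.
have mD : measurable (D : set (measurableTypeR R)) 
  by apply: countable_measurable => //; exact: measurable_set1.
have e20 : 0 < e / 2 by rewrite divr_gt0.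
have [|V [cV VX Ve]] := lebesgue_regularity_inner mX _ e20.
  apply: (@le_lt_trans _ _ (unit_prob [set: R])).
    by rewrite /unit_prob /mrestr; apply: le_measure; rewrite ?inE//;
      [exact: measurableI|move=> x []].
  by rewrite probability_setT ltry.
have Doo : (lebesgue_measure D < +oo)%E by rewrite D0 ltry.
have [U [oU DU Ue]] := lebesgue_regularity_outer mD Doo e20.
have mU := open_measurable oU.
have mV : measurable (V : set (measurableTypeR R)) by exact: compact_measurable.
pose W := V `&` ~` U.
have cW : compact W by apply: compact_closedI; last exact: open_closedC.
have mW : measurable (W : set (measurableTypeR R)) by exact: compact_measurable.
have cphiW : compact (phi @` W).
  apply: continuous_compact => //; apply: continuous_in_subspaceT => x.
  rewrite inE => -[_ Ux]; apply: phi_cont => Dx; apply: Ux; exact: DU.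
apply: (@le_trans _ _ (nu (phi @` W) + e%:E)%E); last first.
  rewrite leeD2r//; apply: ereal_sup_ubound; exists (phi @` W) => //;
    split => //.
  by move=> _ [x [Vx _] <-]; have [] := VX _ Vx.
have WX : W `<=` phi @^-1` (phi @` W) `&` `[0%R, 1%R[%classic.
  by move=> x Wx; split; [exists x|have [] := VX _ Wx.1].
have mphiW : measurable
  (phi @^-1` (phi @` W) `&` `[0%R, 1%R[%classic : set (measurableTypeR R)).
  apply: measurableI => //; rewrite -[_ @^-1` _]setTI.
  apply: continuous_off_measurable => //; apply: closed_measurable_P1.
  by apply: compact_closed => //; exact: hausdorff_P1.
rewrite !nuE; set X1 := _ `&` _ in mX VX Ve *.
have UD : (lebesgue_measure (U `&` V) <= (e / 2)%:E)%E.
  apply: (@le_trans _ _ (lebesgue_measure U)).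
    by apply: le_measure; rewrite ?inE//; exact: measurableI.
  rewrite -(setDUK DU) measureU//; last 2 first.
  - exact: measurableD.
  - by apply/seteqP; split => // x [? []].
  by rewrite [X in (X + _)%E](_ : _ = 0%E)// add0e ltW.
have X1sub : X1 `<=` W `|` ((X1 `\` V) `|` (U `&` V)).
  move=> x X1x; have [Vx|Vx] := pselect (V x); last by right; left.
  by have [Ux|Ux] := pselect (U x); [right; right|left].
apply: le_trans (_ :
  (lebesgue_measure (W `|` ((X1 `\` V) `|` (U `&` V))) <= _)%E).
  apply: le_measure; rewrite ?inE//.
  by apply: measurableU => //; apply: measurableU;
    [exact: measurableD|exact: measurableI].
apply: le_trans (measureU2 _ _ _) _ => //.
  by apply: measurableU; [exact: measurableD|exact: measurableI].
apply: leeD.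
  by apply: le_measure; rewrite ?inE.
apply: le_trans (measureU2 _ _ _) _; [exact: measurableD|exact: measurableI|].
by rewrite [e in leRHS]splitr EFinD leeD// ltW.
Qed.

End Pushforward.

(** * Points of E in annuli of large modulus *)

Section Splitting.
Context {R : realType} {K : closedFieldType} (v : nonarch_absval R K).
Hypothesis v_nontrivial : nontrivial v.
Implicit Types (S T : P1 v) (E : set (P1 v)).

Lemma bounded_moduliP E : bounded_moduli E -> exists2 M : R, 0 <= M &
  forall S S', separating_annulus E S S' -> modulus S S' <= M.
Proof.
rewrite /bounded_moduli; set s := ereal_sup _ => soo.
have s0 : (0 <= s)%E by apply: ereal_sup_ubound; left.
have sfin : s \is a fin_num by rewrite ge0_fin_numE.
exists (fine s); first exact: fine_ge0.
move=> S S' SS'; rewrite -lee_fin fineK//; apply: ereal_sup_ubound; right.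
by exists (S, S').
Qed.

(** The annulus between the points [P] and [Q] above [S] of diameters [q * rho] and [rho] has
    modulus exactly [- ln q], so it does not separate [E]. As [E] has points on both sides of it,
    [E] meets it. *)
Lemma bounded_moduli_split E (q r : R) S (rho : R) :
  0 < q -> q < 1 ->
  (forall S S', separating_annulus E S S' -> modulus S S' < - ln q) ->
  (r%:E < diam_infty E)%E -> 0 < rho -> rho <= r ->
  E S -> (diam S <= (q * rho)%:E)%E ->
  exists T, [/\ E T, ((q * rho)%:E < hsia S T)%E & (hsia S T < rho%:E)%E].
Proof.
move=> q0 q1 Emod rE rho0 rhor ES Sqr.
have qrho : 0 < q * rho by exact: mulr_gt0.
have qr_lt : q * rho < rho by rewrite gtr_pMl.
have Srho : (diam S <= rho%:E)%E by rewrite (le_trans Sqr)// lee_fin ltW.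
have [P [SP Pd _]] := exists_above v_nontrivial Sqr.
have [Q [SQ Qd _]] := exists_above v_nontrivial Srho.
have PQ : (P < Q)%O.
  by apply: lt_diam_above SP SQ _ => //; rewrite Pd Qd lte_fin.
have HP : H1 P.
  by apply: diam_H1; rewrite ?Pd ?lte_fin// => PE; rewrite PE in Pd.
have HQ : H1 Q.
  by apply: diam_H1; rewrite ?Qd ?lte_fin// => QE; rewrite QE in Qd.
have UPQ : Udir P Q = [set T | ~ (T <= P)%O].
  by apply: Udir_up => // h; rewrite (lt_geF PQ) in h.
have UQP := Udir_down v_nontrivial PQ.
(* Some two points of [E] are more than [r] apart; by the ultrametric inequality one of them is more
   than [r] away from [S]. *)
have [T' ET' ST'] : exists2 T, E T & (rho%:E < hsia S T)%E.
  move: rE => /ereal_sup_gt[_ [T1 ET1 [T2 ET2 <-]] rT].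
  have := lt_le_trans rT (hsia_ultra v_nontrivial T1 T2 S).
  rewrite lt_max => /orP[h|h]; [exists T1 => //|exists T2 => //].
    by rewrite hsiaC; apply: le_lt_trans h; rewrite lee_fin.
  by apply: le_lt_trans h; rewrite lee_fin.
have : ~ annulus P Q `<=` ~` E.
  move=> PQE; have : separating_annulus E P Q.
    split=> //; split=> //.
      by exists S; split => //; rewrite UPQ /=; apply.
    exists T'; split => //; rewrite UQP /= => T'P.
    have T'Q := le_trans (le_lubl v_nontrivial T' P) (ltW T'P).
    have := hsia_le v_nontrivial SQ T'Q.
    by rewrite leNgt Qd ST'.
  move=> /Emod; rewrite /modulus Pd Qd /= invfM mulrCA mulfV ?gt_eqF// mulr1.
  by rewrite lnV ?posrE// ltxx.
move=> /existsNP[T] /not_implyP[[TPQ TQP] /contrapT ET]; exists T; split => //.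
  rewrite -Pd ltNge; apply/negP => h; move: TPQ; rewrite UPQ /=; apply.
  by apply/(le_above_hsia v_nontrivial _ SP); rewrite hsiaC.
rewrite hsiaC -Qd; apply/(lt_above_hsia v_nontrivial _ SQ).
move: TQP; rewrite UQP /=; apply: le_lt_trans.
apply: lub_le => //; first exact: le_lubl.
exact: le_trans SP (le_lubr v_nontrivial T P).
Qed.

End Splitting.

(** * The binary tree of points of E *)

Section BinaryTree.
Context {R : realType} {K : closedFieldType} (v : nonarch_absval R K).
Hypothesis v_nontrivial : nontrivial v.
Variables (E : set (P1 v)) (q r : R) (S0 : P1 v).
Implicit Types (S T : P1 v).
Hypotheses (E_compact : compact E) (ES0 : E S0) (S0oo : S0 <> Infty v).
Hypotheses (S0r : (diam S0 <= r%:E)%E) (q0 : 0 < q) (q1 : q < 1) (r0 : 0 < r).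
Hypothesis E_split : forall S (rho : R), 0 < rho -> rho <= r -> E S ->
  (diam S <= (q * rho)%:E)%E ->
  exists T, [/\ E T, ((q * rho)%:E < hsia S T)%E & (hsia S T < rho%:E)%E].

Let rad n := q ^+ n * r.

Let rad_gt0 n : 0 < rad n. Proof. by rewrite mulr_gt0// exprn_gt0. Qed.

Let radS n : rad n.+1 = q * rad n. Proof. by rewrite /rad exprS mulrA. Qed.

Let rad_le m n : (m <= n)%N -> rad n <= rad m.
Proof.
by move=> mn; rewrite ler_pM2r// ler_wiXn2l// ltW.
Qed.

Lemma hsia_fin_neq S T (a : R) : (hsia S T <= a%:E)%E -> S <> Infty v.
Proof.
move=> h SE; move: h; rewrite /hsia SE.
by have /Infty_le -> := le_lubl v_nontrivial (Infty v) T.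
Qed.

(* In the first alternative the vertex has a single child, and all leaves above
   it equal [S], which is at Hsia distance [diam S] from itself. *)
Definition sibling_spec n S T := [/\ E T, T <> Infty v &
  (T = S /\ ((rad n.+1)%:E < diam S)%E) \/
  [/\ (diam S <= (rad n.+1)%:E)%E, ((rad n.+1)%:E < hsia S T)%E &
      (hsia S T < (rad n)%:E)%E]].

(** The conditions on [S] stand under the existential so that [sibling] is a total function. *)
Lemma sibling_exists n S : exists T,
  E S -> S <> Infty v -> sibling_spec n S T.
Proof.
have [ES|nES] := pselect (E S); last by exists S.
have [Sr|Sr] := leP (diam S) (rad n.+1)%:E; last first.
  by exists S => _ Soo; split => //; left.
move: (Sr); rewrite radS => /(E_split (rad_gt0 n) _ ES)[|T [ET ST TS]].
  by have := rad_le (leq0n n); rewrite /rad expr0 mul1r.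
exists T => _ _; split => //; last by right; rewrite radS; split => //;
  rewrite -radS.
by move/ltW: TS; rewrite hsiaC; exact: hsia_fin_neq.
Qed.

Definition sibling n S : P1 v := projT1 (cid (sibling_exists n S)).

Lemma siblingP n S : E S -> S <> Infty v -> sibling_spec n S (sibling n S).
Proof. by rewrite /sibling; case: cid. Qed.

(* [node n k] corresponds to the dyadic interval from [k / 2^n] to
   [(k + 1) / 2^n]. *)
Fixpoint node n k : P1 v :=
  if n is m.+1 then
    if odd k then sibling m (node m k./2) else node m k./2
  else S0.

Lemma nodeP n k : E (node n k) /\ node n k <> Infty v.
Proof.
elim: n k => [|n IH] k //=; have [EN Noo] := IH k./2.
by case: ifP => // _; have [] := siblingP n EN Noo.
Qed.

(** The point [S] is added because the ball is empty when [rad n < diam S], as [hsia S S] is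
    [diam S]. *)
Definition cell n S : set (P1 v) := [set S] `|` ballP1 S (rad n).

Lemma closed_cell n S : closed (cell n S).
Proof.
apply: closedU; last exact: closed_ballP1.
apply: accessible_closed_set1; apply: hausdorff_accessible.
exact: hausdorff_P1.
Qed.

Lemma ballP1_le S (a b : R) : a <= b -> ballP1 S a `<=` ballP1 S b.
Proof. by move=> ab T [Too Ta]; split => //;
  rewrite (le_trans Ta)// lee_fin. Qed.

Lemma cellS n k : cell n.+1 (node n.+1 k) `<=` cell n (node n k./2).
Proof.
have ball_le := ballP1_le (rad_le (leqnSn n)).
have [EN Noo] := nodeP n k./2.
rewrite /=; case: ifP => _ T [->|TN]; [|..]; last 2 first.
- by left.
- by right; exact: ball_le.
- have [_ soo [[-> _]|[_ _ /ltW h]]] := siblingP n EN Noo; first by left.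
  by right; split => //; rewrite hsiaC.
have [_ soo [[sE _]|[_ _ /ltW h]]] := siblingP n EN Noo.
  by rewrite sE in TN; right; exact: ball_le.
have [Too Th] := ball_le _ _ TN.
right; split => //.
apply: le_trans (hsia_ultra v_nontrivial _ _ (sibling n (node n k./2))) _.
by rewrite ge_max Th hsiaC.
Qed.

(** With a single child, both cells reduce to [S], whose diameter exceeds [rad n.+1]. Otherwise,
    closer [T] and [T'] would bring [S] and its sibling within [rad n.+1] by the ultrametric
    inequality. *)
Lemma cell_sibling n S T T' : E S -> S <> Infty v ->
  cell n.+1 S T -> cell n.+1 (sibling n S) T' -> ((rad n.+1)%:E < hsia T T')%E.
Proof.
move=> ES Soo ST sT'.
have [Es soo [[sE Sr]|[Sr Ss sS]]] := siblingP n ES Soo.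
  have cellE X : cell n.+1 S X -> X = S.
    move=> [//|[_ XS]]; have := diam_le_hsia v_nontrivial S X.
    by rewrite leNgt hsiaC (le_lt_trans XS).
  by rewrite sE in sT'; rewrite (cellE _ ST) (cellE _ sT') hsiaxx.
rewrite ltNge; apply/negP => TT'; move: Ss; apply/negP; rewrite -leNgt.
have ST_le : (hsia S T <= (rad n.+1)%:E)%E.
  by case: ST => [->|[_ h]]; rewrite ?hsiaxx// hsiaC.
have Ts_le : (hsia T (sibling n S) <= (rad n.+1)%:E)%E.
  case: sT' => [<-//|[_ h]].
  by rewrite (le_trans (hsia_ultra v_nontrivial _ _ T'))// ge_max TT'.
by rewrite (le_trans (hsia_ultra v_nontrivial _ _ T))// ge_max ST_le.
Qed.

(** On negative [x] the truncation is 0, so every real number defines a branch of the tree. *)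
Definition idx n (x : R) : nat := Num.truncn (x * 2 ^+ n).

Lemma idx_half n x : (idx n.+1 x)./2 = idx n x.
Proof.
rewrite /idx exprS mulrCA; set y := x * _.
have half_le m : ((Num.truncn (2 * y))./2 <= m = (Num.truncn y <= m))%N.
  rewrite -ltnS ltn_half_double doubleS ltnS truncn_le_nat truncn_le_nat.
  have -> : (m.*2.+2)%:R = 2 * m.+1%:R :> R by rewrite -natrM mul2n doubleS.
  by rewrite ltr_pM2l.
by apply/eqP; rewrite eqn_leq half_le leqnn/= -half_le.
Qed.

(** At the first level where the binary digits of [x] and [y] differ, their images lie in the cells
    of two siblings, which are too far apart. *)
Lemma idx_agree x y (phi : R -> P1 v) n :
  (forall n z, cell n (node n (idx n z)) (phi z)) ->
  idx 0 x = idx 0 y -> (hsia (phi x) (phi y) <= (rad n)%:E)%E ->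
    idx n x = idx n y.
Proof.
move=> phi_cell xy0; elim: n => [//|n IH] h.
have /IH {IH} xyn : (hsia (phi x) (phi y) <= (rad n)%:E)%E.
  by rewrite (le_trans h)// lee_fin rad_le.
have [EN Noo] := nodeP n (idx n x).
have cx := phi_cell n.+1 x; have cy := phi_cell n.+1 y.
rewrite /= !idx_half -xyn in cx cy.
rewrite -(odd_double_half (idx n.+1 x)) -(odd_double_half (idx n.+1 y)).
rewrite !idx_half xyn; congr (_ + _)%N.
case: (odd _) cx; case: (odd _) cy => // cy cx.
  by have := cell_sibling EN Noo cy cx; rewrite hsiaC ltNge h.
by have := cell_sibling EN Noo cx cy; rewrite ltNge h.
Qed.

(** * Leaves of the tree *)

Lemma cell_le m n x : (m <= n)%N ->
  cell n (node n (idx n x)) `<=` cell m (node m (idx m x)).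
Proof.
elim: n => [|n IH]; first by rewrite leqn0 => /eqP ->.
rewrite leq_eqVlt => /predU1P[-> //|]; rewrite ltnS => /IH; apply: subset_trans.
by rewrite -[in X in _ `<=` X]idx_half; exact: cellS.
Qed.

(** The vertices along the branch of [x] cluster at a point of the compact [E]. From level [n] on
    they lie in the closed cell of level [n], hence so does the cluster point. *)
Lemma leaf_exists x : exists y, E y /\ forall n, cell n (node n (idx n x)) y.
Proof.
have FE : ((fun n => node n (idx n x)) @ \oo) E.
  by exists 0%N => // n _; have [] := nodeP n (idx n x).
have [y [Ey cly]] := E_compact _ FE.
exists y; split => // n.
suff : closure (cell n (node n (idx n x))) y.
  by rewrite -(closure_id _).1//; exact: closed_cell.
rewrite clusterE in cly; apply: cly.
exists n => // m /= nm; apply: (cell_le nm).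
by left.
Qed.

Definition leaf x : P1 v := projT1 (cid (leaf_exists x)).

Lemma leaf_in x : E (leaf x).
Proof. by rewrite /leaf; case: cid => y []. Qed.

Lemma leaf_cell n x : cell n (node n (idx n x)) (leaf x).
Proof. by rewrite /leaf; case: cid => y []. Qed.

Lemma leaf_ball x : ballP1 S0 r (leaf x).
Proof.
case: (leaf_cell 0 x) => [/= ->|]; last by rewrite /= /rad expr0 mul1r.
by split; rewrite ?hsiaxx.
Qed.

Lemma leaf_open_nbhd (U : set (P1 v)) x : open U -> U (leaf x) ->
  exists n, forall y, idx n y = idx n x -> U (leaf y).
Proof.
move=> oU Ux; have [e e0 eU] := open_hsia_nbhd v_nontrivial oU Ux.
have [n ne] : exists n, rad n <= e.
  have : geometric r q @ \oo --> 0 by apply: cvg_geometric;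
    rewrite ger0_norm// ltW.
  move=> /cvgrPdist_le /(_ e e0) [n _ /(_ n (leqnn n))] /=.
  rewrite sub0r normrN ger0_norm; last by rewrite mulr_ge0// ltW// exprn_gt0.
  by rewrite mulrC; exists n.
exists n => y yx.
have := leaf_cell n y; rewrite yx; have := leaf_cell n x.
set S := node n _ => xS yS.
have le_e X Y : (hsia X Y <= (rad n)%:E)%E -> (hsia X Y <= e%:E)%E.
  by move=> /le_trans; apply; rewrite lee_fin.
(* When both leaves are the vertex [S], they are equal, although [hsia S S] may exceed [e]; in the
   other cases they are within [rad n]. *)
case: xS => [/= xS|[xoo xS]]; case: yS => [/= yS|[yoo yS]].
- by rewrite yS -xS.
- by apply: eU; apply: le_e; rewrite xS.
- by apply: eU; apply: le_e; rewrite yS hsiaC.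
- apply: eU; apply: le_e.
  by rewrite (le_trans (hsia_ultra v_nontrivial _ _ S))// ge_max yS hsiaC.
Qed.

Lemma leaf_ball_idx S n x y : ballP1 S (rad n) (leaf x) ->
  ballP1 S (rad n) (leaf y) -> idx 0 x = idx 0 y -> idx n x = idx n y.
Proof.
move=> [_ xS] [_ yS] xy; apply: idx_agree xy _; first exact: leaf_cell.
by rewrite (le_trans (hsia_ultra v_nontrivial _ _ S))// ge_max xS hsiaC.
Qed.

(** These numbers contain all the jumps of the functions [idx n], which vanish on the negative
    axis. *)
Definition dyadic : set R := range (fun p : nat * nat => p.1%:R / 2 ^+ p.2).

Lemma dyadic_countable : countable dyadic.
Proof. exact: sub_countable (card_image_le _ _) (countableP _). Qed.

Lemma idx_locally_constant n x : ~ dyadic x ->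
  \forall y \near x, idx n y = idx n x.
Proof.
move=> Dx; have p2 : 0 < 2 ^+ n :> R by rewrite exprn_gt0.
have upper : \forall y \near x, (idx n y <= idx n x)%N.
  have : x < (idx n x).+1%:R / 2 ^+ n by rewrite ltr_pdivlMr// truncnS_gt.
  move=> xk; apply: filterS (lt_nbhsl xk) => y /= yk.
  by rewrite /idx truncn_le_nat -ltr_pdivlMr.
have lower : \forall y \near x, (idx n x <= idx n y)%N.
  case xk : (idx n x) => [|k]; first by apply: filterE => y; rewrite leq0n.
  have {}xk : k.+1%:R / 2 ^+ n < x.
    rewrite lt_neqAle; apply/andP; split.
      by apply/eqP => xE; apply: Dx; exists (k.+1, n).
    by rewrite ler_pdivrMr// -truncn_gt_nat -/(idx n x) xk.
  apply: filterS (lt_nbhsr xk) => y /= ky.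
  by rewrite /idx truncn_gt_nat -ler_pdivrMr// ltW.
by apply: filterS2 upper lower => y h1 h2; apply/eqP; rewrite eqn_leq h1.
Qed.

Lemma leaf_continuous x : ~ dyadic x -> {for x, continuous leaf}.
Proof.
move=> Dx U; rewrite nbhsE => -[V [oV Vx] VU].
have [n nV] := leaf_open_nbhd oV Vx.
by apply: filterS (idx_locally_constant n Dx) => y /nV/VU.
Qed.

(** * Mass and potential of the measure on the leaves *)

Let nu : probability (borelP1 v) R := distribution unit_prob
  (mfun_Sub (mem_set (continuous_off_measurable dyadic_countable
    leaf_continuous))).

Let nuE A : nu A = lebesgue_measure (leaf @^-1` A `&` `[0%R, 1%R[%classic).
Proof. by []. Qed.

(** All parameters in [[0, 1[] whose leaves lie in the ball share their index of level [n], so they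
    fill at most one dyadic interval of length [2^-n]. *)
Lemma distribution_ball_le S n :
  (nu (ballP1 S (rad n)) <= ((2^-1) ^+ n)%:E)%E.
Proof.
have p2 : 0 < 2 ^+ n :> R by rewrite exprn_gt0.
rewrite nuE; set X := _ `&` _.
have mX : measurable (X : set (measurableTypeR R)).
  apply: measurableI => //; rewrite -[_ @^-1` _]setTI.
  apply: (continuous_off_measurable dyadic_countable leaf_continuous) => //.
  by apply: closed_measurable_P1; exact: closed_ballP1.
have [->|/set0P[x [xS x01]]] := eqVneq X set0.
  by rewrite measure0 lee_fin exprn_ge0// invr_ge0.
have idx0 z : `[0%R, 1%R[%classic z -> idx 0 z = 0%N.
  rewrite /= in_itv/= => /andP[_ z1]; apply/eqP; rewrite -leqn0.
  by rewrite /idx expr0 mulr1 truncn_le_nat.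
pose k := idx n x.
have Xk : X `<=` `[k%:R / 2 ^+ n, k.+1%:R / 2 ^+ n[%classic.
  move=> y [yS y01].
  have <- : idx n y = k by apply: leaf_ball_idx yS xS _; rewrite !idx0.
  move: y01; rewrite /= !in_itv/= => /andP[y0 _].
  rewrite ler_pdivrMr// ltr_pdivlMr//.
  by apply: truncn_itv; rewrite mulr_ge0// ltW.
apply: (@le_trans _ _
  (lebesgue_measure `[k%:R / 2 ^+ n, k.+1%:R / 2 ^+ n[%classic)).
  by apply: le_measure; rewrite ?inE.
rewrite lebesgue_measure_itv/= lte_fin ltr_pM2r ?invr_gt0// ltr_nat ltnSn.
by rewrite -EFinB -mulrBl -natr1 addrAC subrr add0r mul1r exprVn.
Qed.

(** Each level [n] with [hsia S T <= rad n] contributes [- ln q], and there are enough such levels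
    to make up for [ln r - ln (hsia S T)]; infinitely many if the kernel vanishes. *)
Lemma lne_hsia_ge S T : ((ln r)%:E -
  \sum_(0 <= n <oo) (- ln q * \1_(ballP1 S (rad n)) T)%:E <= lne (hsia S T))%E.
Proof.
set b := - ln q; have b0 : 0 < b by rewrite oppr_gt0 ln_lt0// q0 q1.
set G := (\sum_(0 <= n <oo) _)%E.
have g0 n : (0 <= (b * \1_(ballP1 S (rad n)) T)%:E)%E.
  by rewrite lee_fin mulr_ge0// ?(ltW b0)// indicE.
have G0 : (0 <= G)%E by apply: nneseries_ge0 => n _ _; exact: g0.
have Gge N : (forall n, (n < N)%N -> (hsia S T <= (rad n)%:E)%E) ->
  ((b * N%:R)%:E <= G)%E.
  move=> hN; apply: le_trans
    (@nneseries_lim_ge _ _ xpredT 0 N (fun n _ _ => g0 n)).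
  rewrite (eq_big_nat _ _ (F2 := fun=> b%:E)).
    by rewrite sumEFin sumr_const_nat subn0 mulr_natr.
  move=> n /andP[_ nN]; rewrite indicE mem_set ?mulr1//.
  have STn := hN _ nN; split; last by rewrite hsiaC.
  by move: STn; rewrite hsiaC; exact: hsia_fin_neq.
have h0 := hsia_ge0 v_nontrivial S T.
case: (hsia S T) h0 Gge => [h| |]//; last by move=> _ _; rewrite leey.
rewrite lee_fin le_eqVlt => /predU1P[<-|h0] Gge.
  suff -> : G = +oo%E by rewrite addeNy leNye.
  apply/eqyP => A A0; apply: le_trans (Gge (Num.truncn (A / b)).+1 _).
    by rewrite lee_fin -ler_pdivrMl// mulrC ltW// truncnS_gt.
  by move=> n _; rewrite lee_fin ltW.
rewrite lne_EFin//.
suff LG : ((ln r - ln h)%:E <= G)%E.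
  have -> : (ln r)%:E = ((ln h)%:E + (ln r - ln h)%:E)%E.
    by rewrite -EFinD addrC subrK.
  by rewrite lee_subel_addl// addeC leeD2r.
have [L0|L0] := leP (ln r - ln h) 0.
  by apply: le_trans G0; rewrite lee_fin.
(* The levels [n] with [n * b <= ln r - ln h] are those with [h <= rad n]. Counting level 0, they
   are one more than the truncated quotient, so their total exceeds [ln r - ln h]. *)
apply: le_trans (Gge (Num.truncn ((ln r - ln h) / b)).+1 _).
  by rewrite lee_fin -ler_pdivrMl// mulrC ltW// truncnS_gt.
move=> n; rewrite ltnS truncn_ge_nat ?divr_ge0 ?(ltW L0) ?(ltW b0)//.
rewrite ler_pdivlMr// => nb.
rewrite lee_fin -ler_ln ?posrE// /rad lnM ?posrE ?exprn_gt0// lnXn//.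
by move: nb; rewrite /b -mulr_natl; lra.
Qed.

Lemma capacity_ge : ((q ^+ 2 * r)%:E <= capacity (E `&` ballP1 S0 r))%E.
Proof.
have qr0 : 0 < q ^+ 2 * r by rewrite mulr_gt0// exprn_gt0.
have <- : expeR (ln (q ^+ 2 * r))%:E = (q ^+ 2 * r)%:E by rewrite /= lnK ?posrE.
rewrite /capacity lee_expeR.
apply: (@le_trans _ _ (energy nu)); last first.
  apply: ereal_sup_ubound; exists nu => //; split.
    exact: distribution_radon.
  rewrite /supported_by nuE (_ : _ `&` _ = set0) ?measure0//.
  apply/seteqP; split=> // x [nx _]; apply: nx; split; first exact: leaf_in.
  exact: leaf_ball.
apply: (@le_trans _ _ (\int[nu]_x (cst (ln (q ^+ 2 * r))%:E x))%E).
  by rewrite integral_cst//= probability_setT mule1.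
apply: le_integral_nonmeas => S.
have -> : ln (q ^+ 2 * r) = ln r - 2 * (- ln q).
  by rewrite lnM ?posrE ?exprn_gt0// lnXn// -mulr_natl; lra.
apply: (@prob_integral_ge _ _ _ nu (fun n => ballP1 S (rad n))).
- by rewrite oppr_ge0 ln_le0// ltW.
- by move=> n; apply: closed_measurable_P1; exact: closed_ballP1.
- exact: distribution_ball_le.
- exact: lne_hsia_ge.
Qed.

End BinaryTree.

Theorem theorem3 (R : realType) (K : closedFieldType)
    (v : nonarch_absval R K) (v_nontrivial : nontrivial v)
    (v_complete : complete_absval v) (E : set (P1 v)) (E_compact : compact E) :
  bounded_moduli E <-> lower_capacity_density E.
Proof.
split; last exact: lower_capacity_bounded_moduli.
move=> /bounded_moduliP[M M0 EM].
(* The added 1 makes every modulus strictly less than [- ln q] and keeps [q < 1] even if [M = 0]. *)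
pose q := expR (- (M + 1)).
have q0 : 0 < q := expR_gt0 _.
have q1 : q < 1 by rewrite expR_lt1; lra.
exists (q ^+ 2); split; first by rewrite exprn_gt0// exprn_ilt1// ltW.
move=> S r ES Soo Sr rE.
have r0 : 0 < r by rewrite -lte_fin (le_lt_trans _ Sr)// diam_ge0.
apply: (capacity_ge v_nontrivial E_compact ES Soo (ltW Sr) q0 q1 r0) =>
  T rho rho0 rhor ET Trho.
apply: (bounded_moduli_split v_nontrivial q0 q1 _ rE) => // S1 S2 /EM h.
by rewrite /q expRK opprK (le_lt_trans h)// ltrDl.
Qed.
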